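(* Let $d\ge 2$ and $n\ge 2$ be integers. The subset $$\mathcal K_{d;\le n}=\{\mathbf c\in\mathfrak g_{\le n}(\mathbb R^d):\ c_i=0\ (1\le i\le d-1),\ c_{j(i+1)}=0\ (1\le j<i\le d-1),\ c_d>0,\ c_{i(i+1)}>0\ (1\le i\le d-1)\}$$ is a cross-section for the action of $O_d(\mathbb R)$ on $\mathcal U_{d;\le n}\subset\mathfrak g_{\le n}(\mathbb R^d)$. In particular $\mathcal K_{d;\le n}$ induces a moving frame $\rho_d:\mathcal U_{d;\le n}\to O_d(\mathbb R)$ (sending each element to the unique group element bringing it into $\mathcal K_{d;\le n}$).
   Context: Words are finite strings over the alphabet $\{1,\dots,d\}$; $T_{\le n}(\mathbb R^d)=\bigoplus_{k=0}^n(\mathbb R^d)^{\otimes k}$ is the truncated tensor algebra (spanned by words of length $\le n$, product = concatenation, truncated above length $n$), with commutator bracket $[x,y]=xy-yx$. The free step-$n$ nilpotent Lie algebra is $\mathfrak g_{\le n}(\mathbb R^d)=\bigoplus_{k=1}^n W_k\subset T_{\le n}(\mathbb R^d)$ with $W_1=\mathrm{span}\{1,\dots,d\}$ and $W_{k+1}=[W_1,W_k]$. A Lyndon word is a nonempty word strictly smaller (lexicographically) than each of its proper nonempty suffixes; for a Lyndon word $h$ of length $\ge2$ its standard factorization is $h=uv$ with $v$ the longest proper Lyndon suffix. The Lyndon basis is $b_i=i$ for letters and $b_h=[b_u,b_v]$ for the standard factorization; every $\mathbf c\in\mathfrak g_{\le n}(\mathbb R^d)$ is written $\mathbf c=\sum_{h\text{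 Lyndon},|h|\le n}c_h b_h$, defining coordinates $c_h$ (e.g. $c_i$, and $c_{ij}$ for $i<j$ with $b_{ij}=[i,j]$). A matrix $A=(a_{ij})\in O_d(\mathbb R)$ acts on $T_{\le n}(\mathbb R^d)$ by the algebra automorphism sending each letter $i$ to $\sum_j a_{ji}\, j$ (i.e. by $A^{\otimes k}$ on level $k$); this preserves $\mathfrak g_{\le n}(\mathbb R^d)$. Identifying the level-$\le2$ part of $\mathbf c$ with $(v,M)\in\mathbb R^d\oplus\mathfrak{so}(d,\mathbb R)$, $v=(c_1,\dots,c_d)^\top$, $M_{ij}=c_{ij}=-M_{ji}$ for $i<j$, the action on it is $(v,M)\mapsto(Av,AMA^\top)$. Definition of $\mathcal U_{d;\le n}$: On $V_{\mathbb C}=\mathbb C^d\oplus\mathfrak{so}(d,\mathbb C)$ (same coordinates, complex), with $O_d(\mathbb C)=\{A: AA^\top=I\}$ acting by $(Av,AMA^\top)$, let $L^{(1)}=\{c_1=\dots=c_{d-1}=0\}$ and for $2\le i\le d-1$, $L^{(i)}=\{(v,M)\in L^{(i-1)}: c_{k(d-i+2)}=0,\ 1\le k\le d-i\}$. Let $f_1=c_1^2+\dots+c_d^2$; for $2\le i\le d-1$ let $f_i$ be the $O_d(\mathbb C)$-invariant rational function on $V_{\mathbb C}$ whose restriction to $L^{(i-1)}$ is $c_{1(d-i+2)}^2+\dots+c_{(d-i+1)(d-i+2)}^2$; and let $f_d$ be the $O_d(\mathbb C)$-invariant rational function whose restriction to $L^{(d-1)}$ is $c_{12}^2$ (these exist,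 have real coefficients, and are uniquely determined by these restrictions). Then $\mathcal U_{d;\le n}$ is the set of $\mathbf c\in\mathfrak g_{\le n}(\mathbb R^d)$ whose level-$\le2$ part $(v,M)$ lies in the domain of each $f_k$ and satisfies $f_k(v,M)\ne0$ for all $1\le k\le d$. A cross-section for an action of a group $G$ on a manifold $X$ is a submanifold $\mathcal K\subset X$ intersecting each orbit transversally at a unique point. A moving frame is a smooth map $\rho:X\to G$ with $\rho(g\cdot z)=\rho(z)g^{-1}$. *)

(* Defs.v *)
From HB Require Import structures.
From mathcomp Require Import all_boot all_order all_algebra.
From mathcomp Require Import all_classical all_reals all_analysis.
From mathcomp Require Import complex.

Set Implicit Arguments.
Unset Strict Implicit.
Unset Printing Implicit Defensive.

Import Order.TTheory GRing.Theory Num.Theory.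
Local Open Scope ring_scope.

(* Letters 1..d of the paper are the ordinals 0..d-1 of 'I_d
   (paper letter i  <->  ordinal i-1).  Words are seq 'I_d. *)

Fixpoint tn_words_len (d k : nat) : seq (seq 'I_d) :=
  if k is k'.+1 then
    [seq a :: w | a <- enum 'I_d, w <- tn_words_len d k']
  else [:: [::]].

Definition tn_words (d n : nat) : seq (seq 'I_d) :=
  flatten [seq tn_words_len d k | k <- iota 0 n.+1].

(* T_{<=n}(R^d): coordinates indexed by the words of length <= n *)
Definition tn_T (R : realType) (d n : nat) := 'rV[R]_(size (tn_words d n)).

(* coefficient of the word w in x (0 for words of length > n) *)
Definition tn_coef (R : realType) (d n : nat) (x : tn_T R d n)
    (w : seq 'I_d) : R :=
  match @insub _ (fun i => i < size (tn_words d n))%N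
                  'I_(size (tn_words d n)) (index w (tn_words d n)) with
  | Some i => x 0 i
  | None => 0
  end.

Definition tn_mk (R : realType) (d n : nat) (f : seq 'I_d -> R) : tn_T R d n :=
  \row_i f (nth [::] (tn_words d n) i).

Definition tn_mul (R : realType) (d n : nat) (x y : tn_T R d n) : tn_T R d n :=
  tn_mk n (fun w => \sum_(i < (size w).+1)
                     tn_coef x (take i w) * tn_coef y (drop i w)).

Definition tn_br (R : realType) (d n : nat) (x y : tn_T R d n) : tn_T R d n :=
  tn_mul x y - tn_mul y x.

Definition tn_letter (R : realType) (d n : nat) (a : 'I_d) : tn_T R d n :=
  tn_mk n (fun w => (w == [:: a])%:R).

(* W_1 = span of the letters, W_{k+1} = [W_1, W_k] (= span of the brackets
   [a, x], a a letter and x running over a basis of W_k, by bilinearity) *)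
Fixpoint tn_W (R : realType) (d n k : nat) : {vspace tn_T R d n} :=
  match k with
  | 0 => 0%VS
  | 1 => <<[seq tn_letter R n a | a <- enum 'I_d]>>%VS
  | k'.+1 => <<[seq tn_br (tn_letter R n a) x
                 | a <- enum 'I_d, x <- vbasis (tn_W R d n k')]>>%VS
  end.

(* the free step-n nilpotent Lie algebra g_{<=n}(R^d) = W_1 + ... + W_n *)
Definition tn_g (R : realType) (d n : nat) : {vspace tn_T R d n} :=
  (\sum_(1 <= k < n.+1) tn_W R d n k)%VS.

(* A acts by A^{(x)k} on level k: letter i |-> sum_j a_{ji} j, so the
   coefficient of the word w in A.x is
   sum_{|u| = |w|} prod_t a_{w_t u_t} * x_u *)
Definition tn_act (R : realType) (d n : nat) (A : 'M[R]_d) (x : tn_T R d n)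
  : tn_T R d n :=
  tn_mk n (fun w => \sum_(u : (size w).-tuple 'I_d)
      (\prod_(t < size w) A (tnth (in_tuple w) t) (tnth u t)) * tn_coef x u).

(* infinitesimal action of X in so(d): derivative at the identity of
   A |-> A^{(x)k}, i.e. sum_t I (x) .. (x) X (x) .. (x) I *)
Definition tn_dact (R : realType) (d n : nat) (X : 'M[R]_d) (x : tn_T R d n)
  : tn_T R d n :=
  tn_mk n (fun w => \sum_(u : (size w).-tuple 'I_d)
      (\sum_(t < size w)
         X (tnth (in_tuple w) t) (tnth u t) *
         \prod_(s < size w | s != t)
            (tnth (in_tuple w) s == tnth u s)%:R) * tn_coef x u).

Definition orthogonal_mx (K : comNzRingType) (d : nat) (A : 'M[K]_d) : Prop :=
  A *m A^T = 1%:M.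

(* c_i = coefficient of the one-letter word i; for i < j the Lyndon      *)
(* coordinate c_{ij} (b_{ij} = [i,j] = ij - ji) is the coefficient of   *)
(* the word ij.                                                         *)

Definition tn_v (R : realType) (d n : nat) (c : tn_T R d n) : 'cV[R]_d :=
  \col_i tn_coef c [:: i].

Definition tn_M (R : realType) (d n : nat) (c : tn_T R d n) : 'M[R]_d :=
  \matrix_(i, j) (if (i < j)%N then tn_coef c [:: i; j]
                  else if (j < i)%N then - tn_coef c [:: j; i] else 0).

Inductive polyfun (R : rcfType) (d : nat)
  : ('cV[R[i]]_d -> 'M[R[i]]_d -> R[i]) -> Prop :=
| pf_const (a : R[i]) : polyfun (fun _ _ => a)
| pf_v (i : 'I_d) : polyfun (fun v _ => v i 0)
| pf_M (i j : 'I_d) : polyfun (fun _ M => M i j)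
| pf_add f g : polyfun f -> polyfun g -> polyfun (fun v M => f v M + g v M)
| pf_mul f g : polyfun f -> polyfun g -> polyfun (fun v M => f v M * g v M).

Definition skew_mx (K : comNzRingType) (d : nat) (M : 'M[K]_d) : Prop :=
  M^T = - M.

(* the linear subspaces L^{(i)} of V_C (paper indices, 1 <= i <= d-1):
   L^{(1)} = {c_1 = .. = c_{d-1} = 0},
   L^{(i)} = L^{(i-1)} /\ {c_{k(d-i+2)} = 0, 1 <= k <= d-i}
   (0-based: column d-i+1, rows < d-i) *)
Fixpoint tn_L (R : rcfType) (d : nat) (i : nat)
    (v : 'cV[R[i]]_d) (M : 'M[R[i]]_d) : Prop :=
  match i with
  | 0 => True
  | i'.+1 =>
    if i' is 0 then (forall a : 'I_d, (a < d.-1)%N -> v a 0 = 0)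
    else tn_L i' v M /\
         (forall a b : 'I_d, (b : nat) = (d - i')%N -> (a < d - i' - 1)%N ->
            M a b = 0)
  end.

(* the prescribed restriction of f_k to L^{(k-1)}, 2 <= k <= d:
   c_{1(d-k+2)}^2 + ... + c_{(d-k+1)(d-k+2)}^2 for k <= d-1, c_{12}^2 for k = d
   (0-based: column d-k+1, rows < d-k+1) *)
Definition tn_target (R : rcfType) (d k : nat) (M : 'M[R[i]]_d) : R[i] :=
  if k == d then
    \sum_(a < d) \sum_(b < d | ((a : nat) == 0%N) && ((b : nat) == 1%N))
        M a b ^+ 2
  else
    \sum_(a < d) \sum_(b < d | ((b : nat) == (d - k + 1)%N) && (a < b)%N)
        M a b ^+ 2.

(* (P, Q) represents (as P/Q) the O_d(C)-invariant rational function on V_C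
   whose restriction to L^{(k-1)} is tn_target k (for 2 <= k <= d), i.e. f_k *)
Definition represents_f (R : rcfType) (d k : nat)
    (P Q : 'cV[R[i]]_d -> 'M[R[i]]_d -> R[i]) : Prop :=
  [/\ polyfun P, polyfun Q,
      (forall A : 'M[R[i]]_d, orthogonal_mx A ->
       forall (v : 'cV[R[i]]_d) (M : 'M[R[i]]_d), skew_mx M ->
         P (A *m v) (A *m M *m A^T) * Q v M =
         P v M * Q (A *m v) (A *m M *m A^T)),
      (exists (v : 'cV[R[i]]_d) (M : 'M[R[i]]_d),
          [/\ skew_mx M, tn_L (k.-1) v M & Q v M != 0]) &
      (forall (v : 'cV[R[i]]_d) (M : 'M[R[i]]_d), skew_mx M ->
          tn_L (k.-1) v M -> P v M = tn_target k M * Q v M)].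

Definition cplx (R : rcfType) (r : R) : R[i] := Complex r 0.

Definition tn_U (R : realType) (d n : nat) (c : tn_T R d n) : Prop :=
  [/\ c \in tn_g R d n,
      \sum_(i < d) tn_v c i 0 ^+ 2 != 0 &
      (* for 2 <= k <= d, (v, M) is in the domain of f_k and f_k(v,M) != 0 *)
      forall k, (2 <= k <= d)%N ->
        exists P Q, [/\ @represents_f R d k P Q,
          Q (map_mx (@cplx R) (tn_v c)) (map_mx (@cplx R) (tn_M c)) != 0 &
          P (map_mx (@cplx R) (tn_v c)) (map_mx (@cplx R) (tn_M c)) != 0]].

(* the subset K_{d;<=n} (0-based indices):
   c_i = 0 (i < d-1), c_{j(i+1)} = 0 (j < i <= d-2, i.e. a+1 < b),
   c_d > 0, c_{i(i+1)} > 0 *)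
Definition tn_K (R : realType) (d n : nat) (c : tn_T R d n) : Prop :=
  [/\ c \in tn_g R d n,
      forall a : 'I_d, (a < d.-1)%N -> tn_coef c [:: a] = 0,
      forall a b : 'I_d, (a.+1 < b)%N -> tn_coef c [:: a; b] = 0,
      forall a : 'I_d, (a : nat) = d.-1 -> 0 < tn_coef c [:: a] &
      forall a b : 'I_d, (b : nat) = a.+1 -> 0 < tn_coef c [:: a; b]].

(* tangent space of K at any of its points: K is a relatively open subset
   of this linear subspace of g_{<=n} *)
Definition tn_TK (R : realType) (d n : nat) (x : tn_T R d n) : Prop :=
  [/\ x \in tn_g R d n,
      forall a : 'I_d, (a < d.-1)%N -> tn_coef x [:: a] = 0 &
      forall a b : 'I_d, (a.+1 < b)%N -> tn_coef x [:: a; b] = 0].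

(* Smoothness (C^infinity) on a relatively open subset S of a subspace  *)
(* G: all iterated directional derivatives along directions of G exist  *)
(* and are continuous on S.                                             *)
Fixpoint iter_dir_deriv (R : realType) (V W : normedModType R)
    (vs : seq V) (f : V -> W) : V -> W :=
  if vs is v :: vs' then 'D_v (iter_dir_deriv vs' f) else f.

Definition smooth_on (R : realType) (V W : normedModType R)
    (G : V -> Prop) (S : set V) (f : V -> W) : Prop :=
  forall vs : seq V, (forall v, v \in vs -> G v) ->
    (forall x v, S x -> G v -> derivable (iter_dir_deriv vs f) x v) /\
    continuous (from_subspace S (iter_dir_deriv vs f)).

(* Main.v *)
(* Applying M repeatedly to v and orthogonalising (Lanczos) yields vectors
   w_0, w_1, ... attached equivariantly to (v, M). Clearing denominators, they
   become polynomial in (v, M): w_0 = v, w_1 = M v, t_0 = t_1 = 1,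
     w_{j+2} = t_{j+1} |w_j|^2 M w_{j+1} + t_j |w_{j+1}|^2 w_j,
     t_{j+2} = t_{j+1}^2 |w_j|^2,
   and f_k = t_{k-2}^2 |w_{k-1}|^2 / (t_{k-1}^2 |w_{k-2}|^2). On the
   cross-section w_j is a positive multiple of the basis vector e_{d-j}, so an
   orthogonal matrix bringing c into K must have w_j / |w_j| as its row d-j: this
   gives uniqueness, equivariance and smoothness of the frame. Existence is
   obtained by Householder reflections, one column at a time, the invariants f_k
   guaranteeing that the column to be reduced does not vanish. Transversality
   amounts to a triangular linear system for a skew matrix. *)

Require Import Defs.
From HB Require Import structures.
From mathcomp Require Import all_boot all_order all_algebra.
From mathcomp Require Import all_classical all_reals all_analysis.
From mathcomp Require Import complex ring zify.
Import Order.TTheory GRing.Theory Num.Theory.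
Import numFieldNormedType.Exports.
Local Open Scope ring_scope.

Set Implicit Arguments.
Unset Strict Implicit.
Unset Printing Implicit Defensive.

(** * Functions on words *)

(** The recursion clears denominators in the monic Lanczos process q_{j+2} = M q_{j+1} +
    (|q_{j+1}|^2 / |q_j|^2) q_j, with w_j = t_j q_j, so that f_k = |q_{k-1}|^2 / |q_{k-2}|^2.
    Skewness of M removes the term in q_{j+1} and gives the correction its plus sign. Nothing is
    normalised, because the f_k are fractions of polynomials over the complex numbers, where a
    nonzero vector can have a zero sum of squares. Membership in U only says that some fraction P/Q
    represents each f_k. The inclusion of K in U is therefore proved by exhibiting the Lanczos
    fraction, whereas existence has to control an arbitrary fraction: at a real point that some
    orthogonal A moves into the relevant subspace, P must be Q times the prescribed value at the
    moved point. Hence a vanishing column would force P to vanish. The reduction itself stays over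
    the reals, where nonzero vectors have positive norm. *)

Section WordFunctions.
Variables (R : realType) (d : nat).
Implicit Types (A X : 'M[R]_d) (f g : seq 'I_d -> R) (w : seq 'I_d).

(** The tensor-power action, contracted one letter at a time; the remaining letters see the shifted
    function [fun u => f (b :: u)]. This makes induction on words possible, unlike the sum over
    tuples in [tn_act]. *)
Fixpoint wact A f w {struct w} : R :=
  if w is a :: w' then \sum_b A a b * wact A (fun u => f (b :: u)) w'
  else f [::].

(** The Leibniz rule on words: X hits either the first letter or one of the later ones. *)
Fixpoint wdact X f w {struct w} : R :=
  if w is a :: w' then
    \sum_b X a b * f (b :: w') + wdact X (fun u => f (a :: u)) w'
  else 0.

Definition wconv f g w : R :=
  \sum_(i < (size w).+1) f (take i w) * g (drop i w).

Lemma wconv_nil f g : wconv f g [::] = f [::] * g [::].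
Proof. by rewrite /wconv big_ord1. Qed.

Lemma wconv_cons f g a w :
  wconv f g (a :: w) = f [::] * g (a :: w) + wconv (fun u => f (a :: u)) g w.
Proof. by rewrite /wconv big_ord_recl. Qed.

Lemma eq_wconv f g f' g' w :
  (forall u, (size u <= size w)%N -> f u = f' u) ->
  (forall u, (size u <= size w)%N -> g u = g' u) ->
  wconv f g w = wconv f' g' w.
Proof.
move=> Hf Hg; apply: eq_bigr => i _; congr (_ * _); [apply: Hf|apply: Hg].
  by rewrite size_take; case: ifP => // /ltnW.
by rewrite size_drop leq_subr.
Qed.

Lemma eq_wact A f g w :
  (forall u, size u = size w -> f u = g u) -> wact A f w = wact A g w.
Proof.
elim: w f g => [|a w IH] f g H /=; first exact: H.
by apply: eq_bigr => b _; congr (_ * _); apply: IH => u Hu; rewrite H //= Hu.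
Qed.

Lemma eq_wdact X f g w :
  (forall u, size u = size w -> f u = g u) -> wdact X f w = wdact X g w.
Proof.
elim: w f g => [|a w IH] f g H //=; congr (_ + _).
  by apply: eq_bigr => b _; rewrite H.
by apply: IH => u Hu; rewrite H //= Hu.
Qed.

Lemma wactD A f g w : wact A (fun u => f u + g u) w = wact A f w + wact A g w.
Proof.
elim: w f g => [|a w IH] f g //=.
by rewrite -big_split; apply: eq_bigr => b _ /=; rewrite -mulrDr -IH.
Qed.

Lemma wactZ A k f w : wact A (fun u => k * f u) w = k * wact A f w.
Proof.
elim: w f => [|a w IH] f //=.
by rewrite mulr_sumr; apply: eq_bigr => b _ /=; rewrite IH mulrCA.
Qed.

Lemma wdactD X f g w :
  wdact X (fun u => f u + g u) w = wdact X f w + wdact X g w.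
Proof.
elim: w f g => [|a w IH] f g /=; first by rewrite addr0.
rewrite IH addrACA -big_split; congr (_ + _); apply: eq_bigr => b _ /=.
by rewrite mulrDr.
Qed.

Lemma wdactZ X k f w : wdact X (fun u => k * f u) w = k * wdact X f w.
Proof.
elim: w f => [|a w IH] f /=; first by rewrite mulr0.
rewrite IH mulrDr mulr_sumr; congr (_ + _).
by apply: eq_bigr => b _; rewrite mulrCA.
Qed.

Lemma wconvDl f f' g w :
  wconv (fun u => f u + f' u) g w = wconv f g w + wconv f' g w.
Proof.
by rewrite /wconv -big_split; apply: eq_bigr => i _ /=; rewrite mulrDl.
Qed.

Lemma wconv_suml (F : 'I_d -> seq 'I_d -> R) (k : 'I_d -> R) g w :
  wconv (fun u => \sum_b k b * F b u) g w = \sum_b k b * wconv (F b) g w.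
Proof.
rewrite /wconv; under [RHS]eq_bigr do rewrite mulr_sumr.
rewrite exchange_big; apply: eq_bigr => i _ /=; rewrite mulr_suml.
by apply: eq_bigr => b _; rewrite mulrA.
Qed.

(** Cutting a word into prefix and suffix commutes with acting letter by letter. The induction
    changes f into its shifts, so f has to stay general. *)
Lemma wact_conv A f g w : wact A (wconv f g) w = wconv (wact A f) (wact A g) w.
Proof.
elim: w f g => [|a w IH] f g; first by rewrite /= !wconv_nil.
rewrite wconv_cons /= (@wconv_suml (fun b => wact A (fun u => f (b :: u)))).
rewrite mulr_sumr -big_split; apply: eq_bigr => b _ /=.
rewrite (@eq_wact _ _ (fun u => f [::] * g (b :: u) +
  wconv (fun u => f (b :: u)) g u)); last by move=> u _; exact: wconv_cons.
by rewrite wactD wactZ IH mulrDr mulrCA.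
Qed.

Lemma wdact_conv X f g w :
  wdact X (wconv f g) w = wconv (wdact X f) g w + wconv f (wdact X g) w.
Proof.
elim: w f g => [|a w IH] f g; first by rewrite /= !wconv_nil /= mul0r mulr0 addr0.
rewrite !wconv_cons /=.
rewrite (@eq_wdact _ _ (fun u => f [::] * g (a :: u) +
  wconv (fun u => f (a :: u)) g u)); last by move=> u _; exact: wconv_cons.
rewrite wdactD wdactZ IH mul0r add0r wconvDl.
rewrite (@wconv_suml (fun b u => f (b :: u)) (X a)) mulrDr mulr_sumr.
under eq_bigr do rewrite wconv_cons mulrDr mulrCA.
by rewrite big_split /=; ring.
Qed.

Lemma reindex_tuple_cons k (F : k.+1.-tuple 'I_d -> R) :
  \sum_u F u = \sum_b \sum_(u : k.-tuple 'I_d) F [tuple of b :: u].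
Proof.
rewrite pair_big /=.
rewrite (reindex (fun p : 'I_d * k.-tuple 'I_d => [tuple of p.1 :: p.2])) //=.
exists (fun u => (thead u, [tuple of behead u])) => [[b u] _ | u _] /=.
  by congr pair; apply: val_inj.
by apply/esym; rewrite [LHS]tuple_eta; apply: val_inj.
Qed.

Lemma wact_tuple A f w :
  \sum_(u : (size w).-tuple 'I_d)
    (\prod_(t < size w) A (tnth (in_tuple w) t) (tnth u t)) * f u = wact A f w.
Proof.
elim: w f => [|a w IH] f /=.
  rewrite (big_pred1 [tuple]) => [|u]; first by rewrite big_ord0 mul1r.
  by apply/esym/eqP; exact: tuple0.
rewrite reindex_tuple_cons; apply: eq_bigr => b _.
rewrite -IH mulr_sumr; apply: eq_bigr => u _.
rewrite big_ord_recl !tnth0 -mulrA; congr (_ * _); congr (_ * _).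
apply: eq_bigr => i _; rewrite tnthS; congr (A _ _).
by rewrite !(tnth_nth a) /=.
Qed.

Lemma prod_tnth_eq w (u : (size w).-tuple 'I_d) :
  \prod_(t < size w) (tnth (in_tuple w) t == tnth u t)%:R
    = (u == in_tuple w)%:R :> R.
Proof.
case: eqP => [->|neq]; first by rewrite big1 // => t _; rewrite eqxx.
apply/eqP/prodf_eq0.
have [t Ht|H] := pickP [pred t | tnth (in_tuple w) t != tnth u t].
  by exists t => //; rewrite (negbTE Ht).
case: neq; apply: eq_from_tnth => t.
by have /= /negbFE/eqP -> := H t.
Qed.

Lemma wdact_tuple X f w :
  \sum_(u : (size w).-tuple 'I_d)
    (\sum_(t < size w)
       X (tnth (in_tuple w) t) (tnth u t) *
       \prod_(s < size w | s != t)
         (tnth (in_tuple w) s == tnth u s)%:R) * f u = wdact X f w.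
Proof.
elim: w f => [|a w IH] f /=.
  rewrite (big_pred1 [tuple]) => [|u]; first by rewrite big_ord0 mul0r.
  by apply/esym/eqP; exact: tuple0.
rewrite reindex_tuple_cons.
have tnw i : tnth (in_tuple (a :: w)) (lift ord0 i) = tnth (in_tuple w) i.
  by rewrite !(tnth_nth a).
(* If X acts at the first position, the Kronecker factors force the tails to agree; if it acts
   later, they force a = b. *)
have E b (u : (size w).-tuple 'I_d) :
    \sum_(t < (size w).+1)
       X (tnth (in_tuple (a :: w)) t) (tnth [tuple of b :: u] t) *
       \prod_(s < (size w).+1 | s != t)
         (tnth (in_tuple (a :: w)) s == tnth [tuple of b :: u] s)%:R
    = X a b * (u == in_tuple w)%:R + (a == b)%:R *
      \sum_(t < size w) X (tnth (in_tuple w) t) (tnth u t) *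
        \prod_(s < size w | s != t) (tnth (in_tuple w) s == tnth u s)%:R.
  rewrite big_ord_recl; congr (_ + _).
    rewrite !tnth0 big_mkcond big_ord_recl /= mul1r; congr (_ * _).
    by rewrite -prod_tnth_eq; apply: eq_bigr => i _; rewrite tnthS tnw.
  rewrite mulr_sumr; apply: eq_bigr => i _; rewrite tnthS tnw mulrCA.
  congr (_ * _); rewrite big_mkcond big_ord_recl /= !tnth0; congr (_ * _).
  rewrite [RHS]big_mkcond; apply: eq_bigr => j _.
  by rewrite (inj_eq lift_inj) tnthS tnw.
transitivity (\sum_b (X a b * f (b :: w) + (a == b)%:R *
    wdact X (fun u => f (b :: u)) w)).
  apply: eq_bigr => b _; rewrite -IH.
  under eq_bigr do rewrite E mulrDl.
  rewrite big_split /=; congr (_ + _); last first.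
    by rewrite mulr_sumr; apply: eq_bigr => u _; rewrite mulrA.
  rewrite (bigD1 (in_tuple w)) //= eqxx mulr1 big1 ?addr0 //.
  by move=> u /negbTE ->; rewrite mulr0 mul0r.
rewrite big_split /=; congr (_ + _).
rewrite (bigD1 a) //= eqxx mul1r big1 ?addr0 // => b /negbTE.
by rewrite eq_sym => ->; rewrite mul0r.
Qed.

End WordFunctions.

(** * The truncated tensor algebra *)

Section TensorAlgebra.
Variables (R : realType) (d n : nat).
Implicit Types (x y z : tn_T R d n) (A X : 'M[R]_d) (w : seq 'I_d).

Lemma mem_tn_words_len k w : (w \in tn_words_len d k) = (size w == k).
Proof.
elim: k w => [|k IH] [|a w] //=.
  by apply/negbTE/negP => /allpairsP[[b u] [_ _]].
rewrite eqSS -IH; apply/allpairsP/idP => [[[b u] /= [_ Hu [_ ->]]] //|Hw].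
by exists (a, w); rewrite /= mem_enum.
Qed.

Lemma mem_tn_words w : (w \in tn_words d n) = (size w <= n)%N.
Proof.
apply/flatten_mapP/idP => [[k]|Hw].
  by rewrite mem_iota mem_tn_words_len add0n ltnS => Hk /eqP ->.
by exists (size w); rewrite ?mem_iota ?mem_tn_words_len.
Qed.

Lemma tn_coef_mk (f : seq 'I_d -> R) w :
  tn_coef (tn_mk n f) w = if (size w <= n)%N then f w else 0.
Proof.
rewrite /tn_coef -mem_tn_words -index_mem; case: insubP => [i ->|/negbTE -> //].
move=> Hi; rewrite mxE Hi nth_index // -index_mem -Hi.
exact: ltn_ord.
Qed.

End TensorAlgebra.

Lemma uniq_tn_words_len d k : uniq (tn_words_len d k).
Proof.
elim: k => //= k IH; apply: allpairs_uniq => //; first exact: enum_uniq.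
by move=> [a u] [b v] _ _ [-> ->].
Qed.

Lemma uniq_tn_words d n : uniq (tn_words d n).
Proof.
elim: n => [|n IH] //.
rewrite /tn_words -addn1 iotaD map_cat flatten_cat cat_uniq -/(tn_words d n) IH.
rewrite [map _ _]/= -/(tn_words_len d n.+1) /flatten [foldr _ _ _]/= cats0.
rewrite -/(tn_words_len d n.+1) uniq_tn_words_len andbT; apply/hasPn => w.
by rewrite mem_tn_words_len mem_tn_words => /eqP ->; rewrite ltnn.
Qed.

(** * The Lie algebra, its stability under the group and its infinitesimal action, and levels one
    and two *)

Section LieAlgebra.
Variables (R : realType) (d n : nat).
Implicit Types (x y z : tn_T R d n) (A X : 'M[R]_d) (w : seq 'I_d).

Lemma tn_ext x y :
  (forall w, (size w <= n)%N -> tn_coef x w = tn_coef y w) -> x = y.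
Proof.
move=> H; apply/rowP => i; have := H (nth [::] (tn_words d n) i).
rewrite -(@mem_tn_words d n) mem_nth // => /(_ isT).
rewrite /tn_coef index_uniq ?uniq_tn_words //.
by rewrite insubT //= => Hi; rewrite (_ : Sub _ _ = i) //; apply: val_inj.
Qed.

Lemma tn_coefD x y w : tn_coef (x + y) w = tn_coef x w + tn_coef y w.
Proof. by rewrite /tn_coef; case: insub => [i|]; rewrite ?mxE ?addr0. Qed.

Lemma tn_coefZ k x w : tn_coef (k *: x) w = k * tn_coef x w.
Proof. by rewrite /tn_coef; case: insub => [i|]; rewrite ?mxE ?mulr0. Qed.

Lemma tn_coef0 w : tn_coef (0 : tn_T R d n) w = 0.
Proof. by rewrite /tn_coef; case: insub => [i|]; rewrite ?mxE. Qed.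

Lemma tn_coefN x w : tn_coef (- x) w = - tn_coef x w.
Proof. by rewrite -scaleN1r tn_coefZ mulN1r. Qed.

Lemma tn_coef_mul x y w : (size w <= n)%N ->
  tn_coef (tn_mul x y) w = wconv (tn_coef x) (tn_coef y) w.
Proof. by move=> Hw; rewrite tn_coef_mk Hw. Qed.

Lemma tn_coef_letter a w : (0 < n)%N ->
  tn_coef (tn_letter R n a) w = (w == [:: a])%:R.
Proof.
by move=> n0; rewrite tn_coef_mk; case: leqP => //; case: eqP => // ->; case: n n0.
Qed.

Lemma tn_coef_act A x w : (size w <= n)%N ->
  tn_coef (tn_act A x) w = wact A (tn_coef x) w.
Proof. by move=> Hw; rewrite tn_coef_mk Hw wact_tuple. Qed.

Lemma tn_coef_dact X x w : (size w <= n)%N ->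
  tn_coef (tn_dact X x) w = wdact X (tn_coef x) w.
Proof. by move=> Hw; rewrite tn_coef_mk Hw wdact_tuple. Qed.

Lemma tn_mulDl x y z : tn_mul (x + y) z = tn_mul x z + tn_mul y z.
Proof.
apply: tn_ext => w Hw; rewrite tn_coefD !tn_coef_mul // -wconvDl.
by apply: eq_wconv => // u _; rewrite tn_coefD.
Qed.

Lemma tn_mulDr x y z : tn_mul x (y + z) = tn_mul x y + tn_mul x z.
Proof.
apply: tn_ext => w Hw; rewrite tn_coefD !tn_coef_mul // /wconv -big_split.
by apply: eq_bigr => i _ /=; rewrite tn_coefD mulrDr.
Qed.

Lemma tn_mulZl k x y : tn_mul (k *: x) y = k *: tn_mul x y.
Proof.
apply: tn_ext => w Hw; rewrite tn_coefZ !tn_coef_mul // /wconv mulr_sumr.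
by apply: eq_bigr => i _ /=; rewrite tn_coefZ mulrA.
Qed.

Lemma tn_mulZr k x y : tn_mul x (k *: y) = k *: tn_mul x y.
Proof.
apply: tn_ext => w Hw; rewrite tn_coefZ !tn_coef_mul // /wconv mulr_sumr.
by apply: eq_bigr => i _ /=; rewrite tn_coefZ mulrCA.
Qed.

Lemma tn_brDl x y z : tn_br (x + y) z = tn_br x z + tn_br y z.
Proof. by rewrite /tn_br tn_mulDl tn_mulDr opprD addrACA. Qed.

Lemma tn_brDr x y z : tn_br x (y + z) = tn_br x y + tn_br x z.
Proof. by rewrite /tn_br tn_mulDl tn_mulDr opprD addrACA. Qed.

Lemma tn_brZl k x y : tn_br (k *: x) y = k *: tn_br x y.
Proof. by rewrite /tn_br tn_mulZl tn_mulZr scalerBr. Qed.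

Lemma tn_brZr k x y : tn_br x (k *: y) = k *: tn_br x y.
Proof. by rewrite /tn_br tn_mulZl tn_mulZr scalerBr. Qed.

Lemma tn_act_lin A k x y :
  tn_act A (k *: x + y) = k *: tn_act A x + tn_act A y.
Proof.
apply: tn_ext => w Hw; rewrite tn_coefD tn_coefZ !tn_coef_act // -wactZ -wactD.
by apply: eq_wact => u _; rewrite tn_coefD tn_coefZ.
Qed.

Lemma tn_dact_lin X k x y :
  tn_dact X (k *: x + y) = k *: tn_dact X x + tn_dact X y.
Proof.
apply: tn_ext => w Hw; rewrite tn_coefD tn_coefZ !tn_coef_dact // -wdactZ -wdactD.
by apply: eq_wdact => u _; rewrite tn_coefD tn_coefZ.
Qed.

Lemma tn_act_mul A x y : tn_act A (tn_mul x y) = tn_mul (tn_act A x) (tn_act A y).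
Proof.
apply: tn_ext => w Hw; rewrite tn_coef_act // tn_coef_mul //.
rewrite (@eq_wact _ _ _ _ (wconv (tn_coef x) (tn_coef y))); last first.
  by move=> u Hu; rewrite tn_coef_mul // Hu.
rewrite wact_conv; apply: eq_wconv => u Hu;
  by rewrite tn_coef_act // (leq_trans Hu).
Qed.

Lemma tn_dact_mul X x y :
  tn_dact X (tn_mul x y) = tn_mul (tn_dact X x) y + tn_mul x (tn_dact X y).
Proof.
apply: tn_ext => w Hw; rewrite tn_coefD tn_coef_dact // !tn_coef_mul //.
rewrite (@eq_wdact _ _ _ _ (wconv (tn_coef x) (tn_coef y))); last first.
  by move=> u Hu; rewrite tn_coef_mul // Hu.
rewrite wdact_conv; congr (_ + _); apply: eq_wconv => // u Hu;
  by rewrite tn_coef_dact // (leq_trans Hu).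
Qed.

Lemma tn_actB A x y : tn_act A (x - y) = tn_act A x - tn_act A y.
Proof. by rewrite -scaleN1r addrC tn_act_lin scaleN1r addrC. Qed.

Lemma tn_dactB X x y : tn_dact X (x - y) = tn_dact X x - tn_dact X y.
Proof. by rewrite -scaleN1r addrC tn_dact_lin scaleN1r addrC. Qed.

Lemma tn_act0 A : tn_act A (0 : tn_T R d n) = 0.
Proof. by have := tn_actB A (0 : tn_T R d n) 0; rewrite !subrr. Qed.

Lemma tn_dact0 X : tn_dact X (0 : tn_T R d n) = 0.
Proof. by have := tn_dactB X (0 : tn_T R d n) 0; rewrite !subrr. Qed.

Lemma tn_act_br A x y : tn_act A (tn_br x y) = tn_br (tn_act A x) (tn_act A y).
Proof. by rewrite /tn_br tn_actB !tn_act_mul. Qed.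

Lemma tn_dact_br X x y :
  tn_dact X (tn_br x y) = tn_br (tn_dact X x) y + tn_br x (tn_dact X y).
Proof.
by rewrite /tn_br tn_dactB !tn_dact_mul opprD [- _ - _]addrC addrACA.
Qed.

(** Induction principle for spans; with its counterpart for [tn_g], it reduces linear statements to
    letters and brackets. *)
Lemma span_sub_pred (vs : seq (tn_T R d n)) (P : tn_T R d n -> Prop) :
  P 0 -> (forall k x y, P x -> P y -> P (k *: x + y)) ->
  (forall x, x \in vs -> P x) -> forall x, x \in <<vs>>%VS -> P x.
Proof.
move=> P0 Plin Ps x Hx; rewrite (@coord_span _ _ _ (in_tuple vs) _ Hx); elim/big_rec: _ => // i y _ Py.
by apply: Plin => //; apply: Ps; rewrite mem_nth.
Qed.

Lemma tn_g_sub_pred (P : tn_T R d n -> Prop) :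
  P 0 -> (forall k x y, P x -> P y -> P (k *: x + y)) ->
  (forall k x, (1 <= k <= n)%N -> x \in tn_W R d n k -> P x) ->
  forall x, x \in tn_g R d n -> P x.
Proof.
move=> P0 Plin PW; rewrite /tn_g big_nat_cond.
elim/big_rec: _ => [x|k U Hk IH x].
  by rewrite memv0 => /eqP ->.
move/memv_addP => [y Hy [z Hz ->]]; rewrite -[y]scale1r; apply: Plin.
  by apply: PW Hy; move: Hk; rewrite andbT ltnS.
exact: IH.
Qed.

Lemma tn_W_sub_g k : (1 <= k <= n)%N -> (tn_W R d n k <= tn_g R d n)%VS.
Proof.
move=> /andP[k1 kn]; rewrite /tn_g (big_cat_nat (n := k)) //=; last exact: leqW.
apply: (subv_trans _ (addvSr _ _)).
by rewrite (@big_ltn _ _ _ k) ?ltnS // addvSl.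
Qed.

Lemma tn_letter_W1 a : tn_letter R n a \in tn_W R d n 1.
Proof. by rewrite memv_span //= map_f // mem_enum. Qed.

(** The generators of the next layer only bracket letters with basis vectors; bilinearity extends
    this to all x. *)
Lemma tn_letter_br_W k a x : x \in tn_W R d n k.+1 ->
  tn_br (tn_letter R n a) x \in tn_W R d n k.+2.
Proof.
move=> Hx; rewrite (coord_vbasis Hx).
elim/big_rec: _ => [|i y _ Hy].
  by rewrite -(scale0r (0 : tn_T R d n)) tn_brZr scale0r mem0v.
rewrite tn_brDr tn_brZr memvD // memvZ //; apply: memv_span.
by apply/allpairsP; exists (a, (vbasis (tn_W R d n k.+1))`_i);
  rewrite /= mem_enum mem_nth // size_tuple.
Qed.

Lemma tn_br_W1 k x y : x \in tn_W R d n 1 -> y \in tn_W R d n k.+1 ->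
  tn_br x y \in tn_W R d n k.+2.
Proof.
move=> Hx Hy; move: x Hx; apply: span_sub_pred => [|k' x z Hx Hz|x].
- by rewrite -(scale0r (0 : tn_T R d n)) tn_brZl scale0r mem0v.
- by rewrite tn_brDl tn_brZl memvD // memvZ.
- by move=> /mapP[a _ ->]; exact: tn_letter_br_W.
Qed.

Lemma tn_act_letter A a : (0 < n)%N ->
  tn_act A (tn_letter R n a) = \sum_b A b a *: tn_letter R n b.
Proof.
move=> n0; apply: tn_ext => w Hw; rewrite tn_coef_act //.
rewrite (big_morph _ (fun x y => tn_coefD x y w) (tn_coef0 w)).
under [RHS]eq_bigr do rewrite tn_coefZ tn_coef_letter //.
case: w Hw => [|b [|c w]] Hw /=.
- by rewrite tn_coef_letter // big1 // => b _; rewrite mulr0.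
- rewrite (bigD1 a) //= tn_coef_letter // eqxx mulr1 big1 ?addr0; last first.
    move=> c /negbTE neq; rewrite tn_coef_letter // eqseq_cons neq mulr0 //.
  rewrite (bigD1 b) //= eqxx mulr1 big1 ?addr0 // => c /negbTE neq.
  by rewrite eqseq_cons [_ == c]eq_sym neq mulr0.
- rewrite [RHS]big1 => [|e _]; last by rewrite !eqseq_cons andbF mulr0.
  rewrite big1 // => e _; rewrite big1 ?mulr0 // => e' _.
  (* The zero function is written as a multiple of zero so that homogeneity of [wact] kills it. *)
  rewrite (@eq_wact _ _ _ _ (fun u => 0 * 0)) ?wactZ ?mul0r ?mulr0 // => u _.
  by rewrite tn_coef_letter // !eqseq_cons andbF.
Qed.

Lemma tn_dact_letter X a : (0 < n)%N ->
  tn_dact X (tn_letter R n a) = \sum_b X b a *: tn_letter R n b.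
Proof.
move=> n0; apply: tn_ext => w Hw; rewrite tn_coef_dact //.
rewrite (big_morph _ (fun x y => tn_coefD x y w) (tn_coef0 w)).
under [RHS]eq_bigr do rewrite tn_coefZ tn_coef_letter //.
case: w Hw => [|b [|c w]] Hw.
- by rewrite /= big1 // => b _; rewrite mulr0.
- rewrite /= addr0 (bigD1 a) //= tn_coef_letter // eqxx mulr1 big1 ?addr0; last first.
    move=> c /negbTE neq; rewrite tn_coef_letter // eqseq_cons neq mulr0 //.
  rewrite (bigD1 b) //= eqxx mulr1 big1 ?addr0 // => c /negbTE neq.
  by rewrite eqseq_cons [_ == c]eq_sym neq mulr0.
- rewrite [RHS]big1 => [|e _]; last by rewrite !eqseq_cons andbF mulr0.
  rewrite [LHS]/= big1 ?add0r => [|e _]; last first.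
    by rewrite tn_coef_letter // !eqseq_cons andbF mulr0.
  rewrite big1 ?add0r => [|e _]; last first.
    by rewrite tn_coef_letter // !eqseq_cons andbF mulr0.
  rewrite (@eq_wdact _ _ _ _ (fun u => 0 * 0)) ?wdactZ ?mul0r // => u _.
  by rewrite tn_coef_letter // !eqseq_cons andbF.
Qed.

(** A acts by an algebra endomorphism that maps letters into the first layer, so it maps brackets to
    brackets of the same kind. *)
Lemma tn_act_W A k x : (0 < n)%N ->
  x \in tn_W R d n k -> tn_act A x \in tn_W R d n k.
Proof.
move=> n0; case: k => [|k]; first by rewrite !memv0 => /eqP ->; rewrite tn_act0.
elim: k x => [|k IH]; apply: span_sub_pred.
- by rewrite tn_act0 mem0v.
- by move=> c x y Hx Hy; rewrite tn_act_lin memvD // memvZ.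
- move=> _ /mapP[a _ ->]; rewrite tn_act_letter //.
  by apply: memv_suml => b _; rewrite memvZ // tn_letter_W1.
- by rewrite tn_act0 mem0v.
- by move=> c x y Hx Hy; rewrite tn_act_lin memvD // memvZ.
- move=> _ /allpairsP[[a x] /= [_ Hx ->]]; rewrite tn_act_br tn_act_letter //.
  apply: tn_br_W1; last by apply: IH; exact: vbasis_mem.
  by apply: memv_suml => b _; rewrite memvZ // tn_letter_W1.
Qed.

Lemma tn_dact_W X k x : (0 < n)%N ->
  x \in tn_W R d n k -> tn_dact X x \in tn_W R d n k.
Proof.
move=> n0; case: k => [|k]; first by rewrite !memv0 => /eqP ->; rewrite tn_dact0.
elim: k x => [|k IH]; apply: span_sub_pred.
- by rewrite tn_dact0 mem0v.
- by move=> c x y Hx Hy; rewrite tn_dact_lin memvD // memvZ.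
- move=> _ /mapP[a _ ->]; rewrite tn_dact_letter //.
  by apply: memv_suml => b _; rewrite memvZ // tn_letter_W1.
- by rewrite tn_dact0 mem0v.
- by move=> c x y Hx Hy; rewrite tn_dact_lin memvD // memvZ.
- move=> _ /allpairsP[[a x] /= [_ /vbasis_mem Hx ->]].
  rewrite tn_dact_br tn_dact_letter //.
  apply: memvD; apply: tn_br_W1 => //; last exact: IH.
    by apply: memv_suml => b _; rewrite memvZ // tn_letter_W1.
  exact: tn_letter_W1.
Qed.

Lemma tn_act_g A x : (0 < n)%N ->
  x \in tn_g R d n -> tn_act A x \in tn_g R d n.
Proof.
move=> n0; move: x; apply: tn_g_sub_pred => [|k x y Hx Hy|k x Hk Hx].
- by rewrite tn_act0 mem0v.
- by rewrite tn_act_lin memvD // memvZ.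
- by apply: (subvP (tn_W_sub_g Hk)); exact: tn_act_W.
Qed.

Lemma tn_dact_g X x : (0 < n)%N ->
  x \in tn_g R d n -> tn_dact X x \in tn_g R d n.
Proof.
move=> n0; move: x; apply: tn_g_sub_pred => [|k x y Hx Hy|k x Hk Hx].
- by rewrite tn_dact0 mem0v.
- by rewrite tn_dact_lin memvD // memvZ.
- by apply: (subvP (tn_W_sub_g Hk)); exact: tn_dact_W.
Qed.

(** The first layer has no words of length two. All others are spanned by brackets [a, x], whose
    coefficient at ij is the antisymmetric expression (a = i) x_j - x_i (a = j). *)
Lemma tn_g_coef2_skew x i j : (2 <= n)%N -> x \in tn_g R d n ->
  tn_coef x [:: j; i] = - tn_coef x [:: i; j].
Proof.
move=> n2; have n1 : (0 < n)%N by exact: ltnW.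
move: x; apply: tn_g_sub_pred => [|k x y Hx Hy|[|[|k]] x // _].
- by rewrite !tn_coef0 oppr0.
- by rewrite !tn_coefD !tn_coefZ Hx Hy mulrN opprD.
- move: x; apply: span_sub_pred => [|k x y Hx Hy|_ /mapP[a _ ->]].
  + by rewrite !tn_coef0 oppr0.
  + by rewrite !tn_coefD !tn_coefZ Hx Hy mulrN opprD.
  + by rewrite !tn_coef_letter // !eqseq_cons !andbF oppr0.
- move: x; apply: span_sub_pred => [|k' x y Hx Hy|].
  + by rewrite !tn_coef0 oppr0.
  + by rewrite !tn_coefD !tn_coefZ Hx Hy mulrN opprD.
  + move=> _ /allpairsP[[a x] /= [_ _ ->]].
    rewrite /tn_br !tn_coefD !tn_coefN !tn_coef_mul //.
    rewrite !wconv_cons !wconv_nil !tn_coef_letter //.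
    rewrite !eqseq_cons !andbF !andbT /= !mul0r !mulr0 !add0r !addr0.
    by ring.
Qed.

Lemma tn_v_act A x : (0 < n)%N -> tn_v (tn_act A x) = A *m tn_v x.
Proof.
move=> n0; apply/colP => i; rewrite !mxE tn_coef_act //=.
by apply: eq_bigr => j _; rewrite mxE.
Qed.

Lemma tn_ME x i j : (2 <= n)%N -> x \in tn_g R d n ->
  tn_M x i j = tn_coef x [:: i; j].
Proof.
move=> n2 Hx; rewrite mxE; case: ltngtP => //= [_|/val_inj ->].
  by rewrite [RHS]tn_g_coef2_skew.
have /eqP := tn_g_coef2_skew j j n2 Hx.
by rewrite -subr_eq0 opprK -mulr2n mulrn_eq0 /= => /eqP.
Qed.

Lemma tn_M_skew x : skew_mx (tn_M x).
Proof.
apply/matrixP => i j; rewrite !mxE.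
by case: ltngtP => //= _; rewrite ?opprK ?oppr0.
Qed.

Lemma tn_M_act A x : (2 <= n)%N -> x \in tn_g R d n ->
  tn_M (tn_act A x) = A *m tn_M x *m A^T.
Proof.
move=> n2 Hx; have n1 : (0 < n)%N by exact: ltnW.
apply/matrixP => i j; rewrite tn_ME ?tn_act_g // tn_coef_act //= -mulmxA mxE.
apply: eq_bigr => k _; congr (_ * _); rewrite mxE; apply: eq_bigr => l _.
by rewrite [_^T _ _]mxE mulrC -tn_ME.
Qed.

Lemma tn_coef1_dact X x i : (0 < n)%N ->
  tn_coef (tn_dact X x) [:: i] = (X *m tn_v x) i 0.
Proof.
move=> n0; rewrite tn_coef_dact //= addr0 mxE.
by apply: eq_bigr => j _; rewrite mxE.
Qed.

Lemma tn_coef2_dact X x i j : (2 <= n)%N -> x \in tn_g R d n ->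
  tn_coef (tn_dact X x) [:: i; j] = (X *m tn_M x + tn_M x *m X^T) i j.
Proof.
move=> n2 Hx; rewrite tn_coef_dact //= addr0 !mxE; congr (_ + _).
  by apply: eq_bigr => k _; rewrite -tn_ME.
by apply: eq_bigr => k _; rewrite [_^T _ _]mxE mulrC -tn_ME.
Qed.

End LieAlgebra.

(** * The division-free Lanczos recursion *)

Section Lanczos.
Variables (K : comNzRingType) (d : nat).
Implicit Types (v x : 'cV[K]_d) (M A : 'M[K]_d).

Definition sqnorm x : K := \sum_i x i 0 ^+ 2.

Lemma sqnormE x : sqnorm x = (x^T *m x) 0 0.
Proof. by rewrite mxE; apply: eq_bigr => i _; rewrite mxE. Qed.

Lemma sqnormZ k x : sqnorm (k *: x) = k ^+ 2 * sqnorm x.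
Proof. by rewrite /sqnorm mulr_sumr; apply: eq_bigr => i _; rewrite mxE exprMn. Qed.

Lemma sqnorm_orthogonal A x : orthogonal_mx A -> sqnorm (A *m x) = sqnorm x.
Proof.
by move=> /mulmx1C HA; rewrite !sqnormE trmx_mul -mulmxA (mulmxA A^T) HA mul1mx.
Qed.

(** The state is (w_j, w_{j+1}, t_j, t_{j+1}), since the recursion has three terms. *)
Definition lanczos_step M (s : 'cV[K]_d * 'cV[K]_d * K * K) :=
  let: (w, w', t, t') := s in
  (w', (t' * sqnorm w) *: (M *m w') + (t * sqnorm w') *: w,
   t', t' ^+ 2 * sqnorm w).

Definition lanczos v M j := iter j (lanczos_step M) (v, M *m v, 1, 1).

Definition lvec v M j : 'cV[K]_d := (lanczos v M j).1.1.1.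
Definition lscal v M j : K := (lanczos v M j).1.2.

Lemma lanczosE v M j :
  lanczos v M j = (lvec v M j, lvec v M j.+1, lscal v M j, lscal v M j.+1).
Proof.
by rewrite /lvec /lscal /lanczos !iterS; case: (iter _ _ _) => [[[w w'] t] t'].
Qed.

Lemma lvecSS v M j : lvec v M j.+2 =
  (lscal v M j.+1 * sqnorm (lvec v M j)) *: (M *m lvec v M j.+1) +
  (lscal v M j * sqnorm (lvec v M j.+1)) *: lvec v M j.
Proof.
by rewrite {1}/lvec /lanczos !iterS -/(lanczos v M j) lanczosE.
Qed.

Lemma lscalSS v M j :
  lscal v M j.+2 = lscal v M j.+1 ^+ 2 * sqnorm (lvec v M j).
Proof.
by rewrite {1}/lscal /lanczos !iterS -/(lanczos v M j) lanczosE.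
Qed.

Lemma lanczos_orthogonal A v M j : orthogonal_mx A ->
  lanczos (A *m v) (A *m M *m A^T) j =
  (A *m lvec v M j, A *m lvec v M j.+1, lscal v M j, lscal v M j.+1).
Proof.
move=> HA; have HA' := mulmx1C HA.
have conj x : A *m M *m A^T *m (A *m x) = A *m (M *m x).
  by rewrite -!mulmxA (mulmxA A^T) HA' mul1mx.
elim: j => [|j IH].
  by rewrite /lanczos /= conj.
rewrite /lanczos iterS -/(lanczos _ _ _) IH /= !sqnorm_orthogonal //.
by rewrite lvecSS lscalSS conj mulmxDr !scalemxAr.
Qed.

Lemma lvec_orthogonal A v M j : orthogonal_mx A ->
  lvec (A *m v) (A *m M *m A^T) j = A *m lvec v M j.
Proof. by move=> HA; rewrite {1}/lvec lanczos_orthogonal. Qed.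

Lemma lscal_orthogonal A v M j : orthogonal_mx A ->
  lscal (A *m v) (A *m M *m A^T) j = lscal v M j.
Proof. by move=> HA; rewrite {1}/lscal lanczos_orthogonal. Qed.

(** The scalar shadow of the Lanczos step when w_j = g_j u_j and M is tridiagonal in the vectors
    u_j, with entries b_j; the counter gives access to the current b_j. *)
Definition lcoef_step (b : nat -> K) (p : nat * (K * K * K * K)) :=
  let: (j, (g, g', t, t')) := p in
  (j.+1, (g', t' * g ^+ 2 * g' * b j.+1, t', t' ^+ 2 * g ^+ 2)).

Definition lcoefs a b j := iter j (lcoef_step b) (0%N, (a, a * b 0%N, 1, 1)).

Definition lcoef a b j : K := (lcoefs a b j).2.1.1.1.
Definition ldenom a b j : K := (lcoefs a b j).2.1.2.

Lemma lcoefsE a b j : lcoefs a b j =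
  (j, (lcoef a b j, lcoef a b j.+1, ldenom a b j, ldenom a b j.+1)).
Proof.
rewrite /lcoef /ldenom /lcoefs !iterS.
have : (iter j (lcoef_step b) (0%N, (a, a * b 0%N, 1, 1))).1 = j.
  by elim: j => //= j; case: (iter _ _ _) => [? [[[? ?] ?] ?]] /= ->.
by case: (iter _ _ _) => [? [[[? ?] ?] ?]] /= ->.
Qed.

Lemma lcoefSS a b j : lcoef a b j.+2 =
  ldenom a b j.+1 * lcoef a b j ^+ 2 * lcoef a b j.+1 * b j.+1.
Proof. by rewrite {1}/lcoef /lcoefs !iterS -/(lcoefs a b j) lcoefsE. Qed.

Lemma ldenomSS a b j :
  ldenom a b j.+2 = ldenom a b j.+1 ^+ 2 * lcoef a b j ^+ 2.
Proof. by rewrite {1}/ldenom /lcoefs !iterS -/(lcoefs a b j) lcoefsE. Qed.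

(** With denominators restored this is g_{j+1} / t_{j+1} = b_j g_j / t_j: each monic Lanczos step
    multiplies the length by b_j. It yields both the cancellation in the recursion and the value of
    f_k. *)
Lemma ldenom_lcoef a b j :
  ldenom a b j * lcoef a b j.+1 = ldenom a b j.+1 * lcoef a b j * b j.
Proof.
case: j => [|j]; first by rewrite /ldenom /lcoef /= !mul1r.
by rewrite lcoefSS ldenomSS; ring.
Qed.

(* The recursion recovers, up to scalars, any normalised sequence in which M is
   tridiagonal; only the norms of the [u j] matter, not their orthogonality. *)
Lemma lanczos_tridiagonal v M (u : nat -> 'cV[K]_d) a b m :
  v = a *: u 0%N ->
  (forall j, (j < m)%N -> sqnorm (u j) = 1) ->
  ((0 < m)%N -> M *m u 0%N = b 0%N *: u 1%N) ->
  (forall j, (j.+1 < m)%N -> M *m u j.+1 = b j.+1 *: u j.+2 - b j *: u j) ->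
  forall j, (j <= m)%N -> lvec v M j = lcoef a b j *: u j /\
                         lscal v M j = ldenom a b j.
Proof.
move=> Hv Hu H0 HS.
have H j : (j < m)%N ->
    [/\ lvec v M j = lcoef a b j *: u j, lscal v M j = ldenom a b j,
        lvec v M j.+1 = lcoef a b j.+1 *: u j.+1
      & lscal v M j.+1 = ldenom a b j.+1].
  elim: j => [m0|j IH jm].
    split => //; rewrite {1}/lvec /= Hv.
    by rewrite -scalemxAr H0 // scalerA.
  have jm' := ltnW jm; have [w0 t0 w1 t1] := IH jm'.
  split => //; last by rewrite lscalSS t1 w0 sqnormZ Hu // mulr1 ldenomSS.
  rewrite lvecSS t0 t1 w0 w1 !sqnormZ !Hu // !mulr1 -scalemxAr HS //.
  rewrite lcoefSS scalerBr !scalerA scalerBr !scalerA -addrA -[RHS]addr0.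
  congr (_ + _); first by congr (_ *: _); ring.
  (* The component along u_j that M u_{j+1} produces is exactly what the Lanczos correction
     removes. *)
  rewrite -scaleNr -scalerDl (_ : _ + _ = 0) ?scale0r //.
  transitivity (lcoef a b j * lcoef a b j.+1 *
    (ldenom a b j * lcoef a b j.+1 - ldenom a b j.+1 * lcoef a b j * b j)).
    by ring.
  by rewrite ldenom_lcoef subrr mulr0.
case=> [|j] jm; last by have [] := H j jm.
by split; rewrite /lvec /lscal.
Qed.

End Lanczos.

Lemma lcoef_neq0 (F : fieldType) (a : F) b m : a != 0 ->
  (forall j, (j < m)%N -> b j != 0) ->
  forall j, (j <= m)%N -> (lcoef a b j != 0) && (ldenom a b j != 0).
Proof.
move=> a0 b0.
have H j : (j < m)%N -> [&& lcoef a b j != 0, ldenom a b j != 0,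
    lcoef a b j.+1 != 0 & ldenom a b j.+1 != 0].
  elim: j => [m0|j IH jm].
    by rewrite /lcoef /ldenom /= mulf_neq0 ?b0 ?a0 ?oner_eq0.
  have /and4P[g0 t0 g1 t1] := IH (ltnW jm); rewrite g1 t1 lcoefSS ldenomSS.
  by rewrite !(mulf_neq0, expf_neq0) // b0.
case=> [|j] jm; first by rewrite /lcoef /ldenom /= a0 oner_eq0.
by have /and4P[_ _ -> ->] := H j jm.
Qed.

Lemma lcoef_gt0 (F : realFieldType) (a : F) b m : 0 < a ->
  (forall j, (j < m)%N -> 0 < b j) ->
  forall j, (j <= m)%N -> (0 < lcoef a b j) && (0 < ldenom a b j).
Proof.
move=> a0 b0.
have H j : (j < m)%N -> [&& 0 < lcoef a b j, 0 < ldenom a b j,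
    0 < lcoef a b j.+1 & 0 < ldenom a b j.+1].
  elim: j => [m0|j IH jm].
    by rewrite /lcoef /ldenom /= mulr_gt0 ?b0 ?a0 ?ltr01.
  have /and4P[g0 t0 g1 t1] := IH (ltnW jm); rewrite g1 t1 lcoefSS ldenomSS.
  by rewrite !(mulr_gt0, exprn_gt0) // b0.
case=> [|j] jm; first by rewrite /lcoef /ldenom /= a0 ltr01.
by have /and4P[_ _ -> ->] := H j jm.
Qed.

(** * Lanczos quantities in classes of functions closed under sums and products *)

Section LanczosClosed.
Variables (K : comNzRingType) (d : nat) (T : Type) (E : (T -> K) -> Prop).
Hypothesis E_const : forall a, E (fun _ => a).
Hypothesis E_add : forall f g, E f -> E g -> E (fun t => f t + g t).
Hypothesis E_mul : forall f g, E f -> E g -> E (fun t => f t * g t).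

Lemma closed_ext (f g : T -> K) : f =1 g -> E g -> E f.
Proof. by move=> /funext ->. Qed.

Lemma closed_sum (I : Type) (r : seq I) (P : pred I) (F : I -> T -> K) :
  (forall i, E (F i)) -> E (fun t => \sum_(i <- r | P i) F i t).
Proof.
move=> H; elim: r => [|i r IH].
  by apply: closed_ext (E_const 0) => t; rewrite big_nil.
have := E_add (H i) IH; case Pi: (P i) => HP.
  by apply: closed_ext HP => t; rewrite big_cons Pi.
by apply: closed_ext IH => t; rewrite big_cons Pi.
Qed.

Lemma closed_prod (I : Type) (r : seq I) (F : I -> T -> K) :
  (forall i, E (F i)) -> E (fun t => \prod_(i <- r) F i t).
Proof.
move=> H; elim: r => [|i r IH].
  by apply: closed_ext (E_const 1) => t; rewrite big_nil.
by apply: closed_ext (E_mul (H i) IH) => t; rewrite big_cons.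
Qed.

Lemma closed_sqr (F : T -> K) : E F -> E (fun t => F t ^+ 2).
Proof. by move=> H; apply: closed_ext (E_mul H H) => t. Qed.

Lemma closed_sqnorm (w : T -> 'cV[K]_d) :
  (forall i, E (fun t => w t i 0)) -> E (fun t => sqnorm (w t)).
Proof. by move=> Hw; apply: closed_sum => k; exact: closed_sqr. Qed.

Lemma closed_mulmx (M : T -> 'M[K]_d) (w : T -> 'cV[K]_d) i :
  (forall i j, E (fun t => M t i j)) -> (forall i, E (fun t => w t i 0)) ->
  E (fun t => (M t *m w t) i 0).
Proof.
move=> HM Hw; apply: (@closed_ext _ (fun t => \sum_k M t i k * w t k 0)).
  by move=> t; rewrite mxE.
by apply: closed_sum => k; exact: E_mul.
Qed.

(** The class E is abstract because it is used twice: for polynomial functions over the complex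
    numbers and for the elementary functions behind smoothness. *)
Lemma closed_lanczos (v : T -> 'cV[K]_d) (M : T -> 'M[K]_d) j :
  (forall i, E (fun t => v t i 0)) -> (forall i j, E (fun t => M t i j)) ->
  [/\ forall i, E (fun t => lvec (v t) (M t) j i 0),
      forall i, E (fun t => lvec (v t) (M t) j.+1 i 0),
      E (fun t => lscal (v t) (M t) j) & E (fun t => lscal (v t) (M t) j.+1)].
Proof.
move=> Hv HM; elim: j => [|j [w0 w1 t0 t1]].
  by split => [//|i||]; [exact: closed_mulmx | exact: (E_const 1) | exact: (E_const 1)].
split=> //; last first.
  apply: closed_ext (E_mul (closed_sqr t1) (closed_sqnorm w0)) => t.
  exact: lscalSS.
move=> i; apply: closed_ext (E_add
  (E_mul (E_mul t1 (closed_sqnorm w0)) (closed_mulmx i HM w1))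
  (E_mul (E_mul t0 (closed_sqnorm w1)) (w0 i))) => t.
by rewrite lvecSS !mxE.
Qed.

End LanczosClosed.

(** * Tridiagonal skew-symmetric matrices *)

Section Tridiagonal.
Variables (K : numDomainType) (D : nat).
Implicit Types (v x : 'cV[K]_D.+1) (M A : 'M[K]_D.+1).

(* With [m = d - i] this is the subspace L^(i) of the paper, i >= 1. *)
Definition tridiag_above m v M : Prop :=
  (forall a : 'I_D.+1, (a < D)%N -> v a 0 = 0) /\
  (forall a b : 'I_D.+1, (m < b)%N -> (a.+1 < b)%N -> M a b = 0).

(** Its squared norm is the prescribed restriction of an f_k, and it is the vector that a reflection
    reduces next. *)
Definition upper_col M (c : 'I_D.+1) : 'cV[K]_D.+1 :=
  \col_i (if (i < c)%N then M i c else 0).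

Definition ecol (c : nat) : 'cV[K]_D.+1 := delta_mx (inord c) 0.

Lemma ecolE c (i : 'I_D.+1) : (c <= D)%N -> ecol c i 0 = ((i : nat) == c)%:R.
Proof. by move=> cD; rewrite mxE eqxx andbT -val_eqE /= inordK. Qed.

Lemma sqnorm_ecol c : (c <= D)%N -> sqnorm (ecol c) = 1.
Proof.
move=> cD; rewrite /sqnorm (bigD1 (inord c)) //= ecolE // inordK // eqxx expr1n.
rewrite big1 ?addr0 // => i; rewrite -val_eqE /= inordK // => /negbTE ne.
by rewrite ecolE // ne expr0n.
Qed.

Lemma mul_ecol M c : M *m ecol c = col (inord c) M.
Proof. by rewrite colE. Qed.

Lemma skew_entry M i j : skew_mx M -> M i j = - M j i.
Proof. by move=> HM; have /matrixP/(_ j i) := HM; rewrite !mxE. Qed.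

Lemma skew_diag M i : skew_mx M -> M i i = 0.
Proof.
move=> /(@skew_entry _ i i) /eqP; rewrite -subr_eq0 opprK -mulr2n mulrn_eq0.
by move=> /eqP.
Qed.

Lemma tridiag_above_v m v M : tridiag_above m v M -> v = v (inord D) 0 *: ecol D.
Proof.
move=> [Hv _]; apply/colP => i; rewrite mxE ecolE //.
case: eqP => [iD|ne]; last by rewrite mulr0 Hv // ltn_neqAle -ltnS ltn_ord; lia.
by rewrite mulr1; congr (v _ _); apply: val_inj; rewrite /= inordK.
Qed.

(** Below the diagonal, column c is minus row c, which the reduced columns to its right leave with
    the single entry at c + 1. *)
Lemma tridiag_above_col m v M c : skew_mx M -> tridiag_above m v M ->
  (m <= c < D)%N -> M *m ecol c =
  upper_col M (inord c) - M (inord c) (inord c.+1) *: ecol c.+1.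
Proof.
move=> HM [_ H] /andP[mc cD]; have cD' := ltnW cD.
apply/colP => i; rewrite mul_ecol !mxE eqxx andbT -val_eqE /= !inordK //.
have [ic|ci|ic] := ltngtP i c; rewrite /=.
- by rewrite (_ : _ == _ = false) ?mulr0 ?subr0 //; lia.
- have [ie|ne] := eqVneq (i : nat) c.+1.
    rewrite mulr1 add0r skew_entry //; congr (- M _ _).
    by apply: val_inj; rewrite /= ie inordK.
  rewrite mulr0 subr0 skew_entry // H ?oppr0 //; first by lia.
  by rewrite inordK; lia.
- rewrite (_ : _ == _ = false) ?mulr0 ?subr0; last by lia.
  by rewrite (_ : inord c = i) ?skew_diag //; apply: val_inj; rewrite /= -ic inord_val.
Qed.

Lemma skew_last_col M : skew_mx M -> M *m ecol D = upper_col M (inord D).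
Proof.
move=> HM; apply/colP => i; rewrite mul_ecol !mxE inordK //.
case: ltnP => // Di; rewrite (_ : i = inord D) ?skew_diag //.
by apply: val_inj; rewrite /= inordK //; have := ltn_ord i; lia.
Qed.

Lemma tridiag_above_upper_col m v M c : tridiag_above m v M ->
  (m < c <= D)%N ->
  upper_col M (inord c) = M (inord c.-1) (inord c) *: ecol c.-1.
Proof.
move=> [_ H] /andP[mc cD]; have c1D : (c.-1 <= D)%N by lia.
apply/colP => i; rewrite !mxE eqxx andbT -val_eqE /= !inordK //.
have [ie|ne] := eqVneq (i : nat) c.-1.
  rewrite mulr1 (_ : (_ < _)%N); last by lia.
  by congr (M _ _); apply: val_inj; rewrite /= ie inordK.
by rewrite mulr0; case: ltnP => // ic; rewrite H // inordK //; lia.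
Qed.

(** The superdiagonal read from the bottom right, in the order in which the Lanczos process meets
    it. *)
Definition offdiag M j : K := M (inord (D - j.+1)) (inord (D - j)).

Lemma tridiag_above_mul_ecol m v M j : skew_mx M -> tridiag_above m v M ->
  (m + j.+1 < D)%N ->
  M *m ecol (D - j.+1) = offdiag M j.+1 *: ecol (D - j.+2)
                          - offdiag M j *: ecol (D - j).
Proof.
move=> HM HT mjD; rewrite (tridiag_above_col HM HT) //; last by lia.
rewrite (tridiag_above_upper_col HT); last by lia.
rewrite /offdiag (_ : (D - j.+1).-1 = D - j.+2)%N; last by lia.
by rewrite (_ : (D - j.+1).+1 = D - j)%N //; lia.
Qed.

Lemma tridiag_above_mul_ecol0 m v M : skew_mx M -> tridiag_above m v M ->
  (m < D)%N -> M *m ecol D = offdiag M 0 *: ecol (D - 1).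
Proof.
move=> HM HT mD; rewrite skew_last_col // (tridiag_above_upper_col HT); last by lia.
by rewrite /offdiag subn0 subn1.
Qed.

(** This is the value of f_{j+2} on L^{(j+1)} with denominators cleared, so it also holds where the
    denominator vanishes. *)
Lemma lanczos_restrict v M j : skew_mx M -> tridiag_above (D - j) v M ->
  (j < D)%N ->
  lscal v M j ^+ 2 * sqnorm (lvec v M j.+1) =
  sqnorm (upper_col M (inord (D - j))) *
  (lscal v M j.+1 ^+ 2 * sqnorm (lvec v M j)).
Proof.
move=> HM HT jD.
(* The last vector is the whole unreduced column, with coefficient 1. This is allowed because
   [lanczos_tridiagonal] does not constrain the norm of the last vector. *)
pose u i := if (i <= j)%N then ecol (D - i) else upper_col M (inord (D - j)).
pose b i := if (i < j)%N then offdiag M i else 1.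
pose a := v (inord D) 0.
have H := @lanczos_tridiagonal _ _ v M u a b j.+1.
have {}H : forall i, (i <= j.+1)%N ->
    lvec v M i = lcoef a b i *: u i /\ lscal v M i = ldenom a b i.
  apply: H => [|i ij|_|i ij].
  - by rewrite /u /= subn0; exact: tridiag_above_v HT.
  - by rewrite /u -ltnS ij sqnorm_ecol // leq_subr.
  - rewrite /u /b /= subn0; case: ltnP => [j0|].
      by rewrite (tridiag_above_mul_ecol0 HM HT) //; lia.
    by rewrite leqn0 => /eqP ->; rewrite scale1r subn0 skew_last_col.
  - rewrite /u /b -(ltnS i.+1 j) ij (_ : (i <= j)%N) 1?(_ : (i < j)%N); try lia.
    case: ltnP => ij'; first by rewrite (tridiag_above_mul_ecol HM HT) //; lia.
    rewrite scale1r (tridiag_above_col HM HT); last by lia.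
    rewrite /offdiag (_ : i.+1 = j); last by lia.
    by rewrite (_ : (D - j).+1 = D - i)%N //; lia.
have [w0 t0] := H j (leqnSn j); have [w1 t1] := H j.+1 (leqnn _).
rewrite w0 w1 t0 t1 !sqnormZ /u leqnn ltnn sqnorm_ecol ?leq_subr // mulr1.
rewrite mulrA -exprMn ldenom_lcoef /b ltnn mulr1 exprMn.
by rewrite mulrC.
Qed.

Lemma lanczos_full v M j : skew_mx M -> tridiag_above 0 v M -> (j <= D)%N ->
  lvec v M j = lcoef (v (inord D) 0) (offdiag M) j *: ecol (D - j) /\
  lscal v M j = ldenom (v (inord D) 0) (offdiag M) j.
Proof.
move=> HM HT.
apply: (@lanczos_tridiagonal _ _ v M (fun i => ecol (D - i))) => [|i _|D0|i iD].
- by rewrite subn0; exact: tridiag_above_v HT.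
- by rewrite sqnorm_ecol // leq_subr.
- by rewrite subn0 (tridiag_above_mul_ecol0 HM HT).
- by rewrite (tridiag_above_mul_ecol HM HT).
Qed.

End Tridiagonal.

(** * The rational invariants f_k and the fractions representing them *)

Section Represents.
Variables (R : rcfType) (D : nat).
Local Notation C := (R[i]).
Implicit Types (v : 'cV[C]_D.+1) (M A : 'M[C]_D.+1).

Lemma tn_L_tridiag i v M : tn_L i.+1 v M <-> tridiag_above (D - i) v M.
Proof.
elim: i => [|i IH].
  split=> [H|[H _] //]; split=> // a b; rewrite subn0 => Db.
  by have := ltn_ord b; lia.
rewrite /= -/(tn_L i.+1 v M); split.
  move=> [/IH [Hv HM] Hb]; split=> // a b Db ab.
  have [Db'|Db'] := ltnP (D - i) b; first exact: HM.
  by apply: Hb; have := ltn_ord b; lia.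
move=> [Hv HM]; split; first by apply/IH; split=> // a b Db; apply: HM; lia.
by move=> a b bE ab; apply: HM; lia.
Qed.

(** The separate case k = d fits the general formula: the column concerned has a single entry above
    the diagonal. *)
Lemma tn_target_upper k M : (2 <= k <= D.+1)%N ->
  tn_target k M = sqnorm (upper_col M (inord (D.+1 - k).+1)).
Proof.
move=> kd; set c := inord _ : 'I_D.+1.
have cE : (c : nat) = (D.+1 - k).+1 by rewrite /c inordK; lia.
have sumE (p : 'I_D.+1 -> 'I_D.+1 -> bool) :
    (forall a b, p a b = (b == c) && (a < c)%N) ->
    \sum_a \sum_(b | p a b) M a b ^+ 2 = sqnorm (upper_col M c).
  move=> pE; apply: eq_bigr => a _; rewrite mxE big_mkcond (bigD1 c) //= pE eqxx.
  rewrite big1 ?addr0 /=; last by move=> b /negbTE bc; rewrite pE bc.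
  by case: ifP => // _; rewrite expr0n.
rewrite /tn_target; case: eqP => [kD|_]; apply: sumE => a b; rewrite -val_eqE /=.
  by rewrite cE; lia.
by rewrite cE; lia.
Qed.

Lemma polyfun_target k : polyfun (fun (_ : 'cV[C]_D.+1) M => tn_target k M).
Proof.
pose E f := @polyfun R D.+1 (fun v M => f (v, M)).
suff: E (fun p => tn_target k p.2) by [].
have Ec a : E (fun _ => a) by exact: pf_const.
have Ea f g : E f -> E g -> E (fun t => f t + g t) by exact: pf_add.
have Em f g : E f -> E g -> E (fun t => f t * g t) by exact: pf_mul.
rewrite /tn_target; case: eqP => _; apply: closed_sum => // a;
  apply: closed_sum => // b; apply: (closed_sqr Em); exact: pf_M.
Qed.

Lemma polyfun_lanczos j :
  polyfun (fun (v : 'cV[C]_D.+1) M => lscal v M j ^+ 2) /\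
  polyfun (fun (v : 'cV[C]_D.+1) M => sqnorm (lvec v M j)).
Proof.
pose E f := @polyfun R D.+1 (fun v M => f (v, M)).
suff: E (fun p => lscal p.1 p.2 j ^+ 2) /\ E (fun p => sqnorm (lvec p.1 p.2 j)).
  by [].
have Ec a : E (fun _ => a) by exact: pf_const.
have Ea f g : E f -> E g -> E (fun t => f t + g t) by exact: pf_add.
have Em f g : E f -> E g -> E (fun t => f t * g t) by exact: pf_mul.
have [w _ t _] := @closed_lanczos _ _ _ E Ec Ea Em fst snd j
  (@pf_v R D.+1) (@pf_M R D.+1).
by split; [exact: closed_sqr | exact: closed_sqnorm].
Qed.

(** The point (v0, M0) witnesses that the Lanczos denominator is not identically zero on the
    subspace; the rest holds identically. *)
Lemma represents_f_lanczos j v0 M0 : (j < D)%N ->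
  skew_mx M0 -> tridiag_above (D - j) v0 M0 ->
  lscal v0 M0 j.+1 ^+ 2 * sqnorm (lvec v0 M0 j) != 0 ->
  represents_f j.+2 (fun v M => lscal v M j ^+ 2 * sqnorm (lvec v M j.+1))
                    (fun v M => lscal v M j.+1 ^+ 2 * sqnorm (lvec v M j)).
Proof.
move=> jD HM0 HT0 nz; have [t0 w0] := polyfun_lanczos j.
have [t1 w1] := polyfun_lanczos j.+1.
split.
- exact: pf_mul t0 w1.
- exact: pf_mul t1 w0.
- move=> A HA v M _.
  by rewrite !lvec_orthogonal // !lscal_orthogonal // !sqnorm_orthogonal.
- by exists v0, M0; split=> //; apply/tn_L_tridiag.
- move=> v M HM /tn_L_tridiag HT; rewrite lanczos_restrict // tn_target_upper; last by lia.
  by rewrite (_ : (D.+1 - j.+2).+1 = (D - j)%N) //; lia.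
Qed.

Lemma polyfun_line (P : 'cV[C]_D.+1 -> 'M[C]_D.+1 -> C) v0 v1 M0 M1 :
  polyfun P -> exists p : {poly C}, forall s,
    P (v0 + s *: v1) (M0 + s *: M1) = p.[s].
Proof.
elim=> {P} [a|i|i j|f g _ [p Hp] _ [q Hq]|f g _ [p Hp] _ [q Hq]].
- by exists a%:P => s; rewrite hornerC.
- exists ((v0 i 0)%:P + (v1 i 0)%:P * 'X) => s.
  by rewrite !mxE hornerD hornerM hornerX !hornerC mulrC.
- exists ((M0 i j)%:P + (M1 i j)%:P * 'X) => s.
  by rewrite !mxE hornerD hornerM hornerX !hornerC mulrC.
- by exists (p + q) => s; rewrite hornerD Hp Hq.
- by exists (p * q) => s; rewrite hornerM Hp Hq.
Qed.

Lemma poly_eq0_horner (F : numDomainType) (p : {poly F}) :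
  (forall s, p.[s] = 0) -> p = 0.
Proof.
move=> H; apply/eqP; apply: contraT => p0.
have := @max_poly_roots _ p [seq i%:R | i <- iota 0 (size p)] p0.
rewrite size_map size_iota ltnn => -> //.
  by apply/allP => x _; rewrite /root H.
rewrite map_inj_uniq ?iota_uniq // => i j /eqP.
by rewrite eqr_nat => /eqP.
Qed.

(* The denominator Q may vanish at the point of L^(k-1) under consideration, so
   the factor Q is cancelled along a line to a point where it does not. *)
Lemma represents_f_target k P Q A v M : represents_f k.+2 P Q ->
  orthogonal_mx A -> skew_mx M ->
  tridiag_above (D - k) (A *m v) (A *m M *m A^T) ->
  P v M = tn_target k.+2 (A *m M *m A^T) * Q v M.
Proof.
move=> [HP HQ inv [v0 [M0 [HM0 HL0 Q0]]] rest] HA HM HT.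
have HA' := mulmx1C HA.
have HL : tn_L k.+1 (A *m v) (A *m M *m A^T) by exact/tn_L_tridiag.
move: HL0 => /tn_L_tridiag HT0.
(* The line from the transformed point to (v0, M0) stays in the linear subspace; pulled back by the
   transpose of A, it becomes a line through (v, M). *)
pose lv s := A *m v + s *: (v0 - A *m v).
pose lM s := A *m M *m A^T + s *: (M0 - A *m M *m A^T).
pose B := A^T; have HB : orthogonal_mx B by rewrite /orthogonal_mx trmxK.
have lvB s : B *m lv s = v + s *: (B *m (v0 - A *m v)).
  by rewrite /lv mulmxDr -scalemxAr mulmxA HA' mul1mx.
have lMB s : B *m lM s *m B^T = M + s *: (B *m (M0 - A *m M *m A^T) *m B^T).
  rewrite /lM mulmxDr mulmxDl -scalemxAr -scalemxAl; congr (_ + _).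
  by rewrite trmxK -!mulmxA HA' mulmx1 mulmxA HA' mul1mx.
have [p Hp] := polyfun_line v (B *m (v0 - A *m v)) M
                 (B *m (M0 - A *m M *m A^T) *m B^T) HP.
have [q Hq] := polyfun_line v (B *m (v0 - A *m v)) M
                 (B *m (M0 - A *m M *m A^T) *m B^T) HQ.
have [r Hr] := polyfun_line (A *m v) (v0 - A *m v) (A *m M *m A^T)
                 (M0 - A *m M *m A^T) HQ.
have [t Ht] := polyfun_line (A *m v) (v0 - A *m v) (A *m M *m A^T)
                 (M0 - A *m M *m A^T) (polyfun_target k.+2).
have skewA : skew_mx (A *m M *m A^T).
  by rewrite /skew_mx !trmx_mul trmxK HM mulNmx mulmxN mulmxA.
have skewl s : skew_mx (lM s).
  apply/matrixP => i j; rewrite /lM.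
  have := skew_entry i j skewA; have := skew_entry i j HM0.
  rewrite !mxE => -> ->.
  by ring.
have Ll s : tn_L k.+1 (lv s) (lM s).
  apply/tn_L_tridiag; split=> [a aD|a b ab ab'].
    by move: HT HT0 => [+ _] [+ _] => /(_ a aD) + /(_ a aD); rewrite !mxE => -> ->; ring.
  move: HT HT0 => [_ +] [_ +] => /(_ a b ab ab') + /(_ a b ab ab').
  by rewrite !mxE => -> ->; ring.
(* Here p and q are P and Q on the pulled-back line, and r and t are Q and the target on the line in
   the subspace. Invariance relates P/Q on the two lines, and the prescribed restriction replaces P
   by t r on the second. *)
have E s : ((p - t * q) * r).[s] = 0.
  rewrite hornerM hornerD hornerN hornerM -Hp -Hq -Hr -Ht -lvB -lMB -/(lv s) -/(lM s).
  have := inv B HB (lv s) (lM s) (skewl s).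
  rewrite mulrBl => ->; rewrite (rest _ _ (skewl s) (Ll s)).
  by ring.
(* The polynomial r is nonzero, since r(1) = Q(v0, M0); it can be cancelled, and s = 0 gives the
   claim. *)
have := poly_eq0_horner E => /eqP; rewrite mulf_eq0 => /orP[|]; last first.
  move=> /eqP r0; move: Q0; rewrite -[v0](subrK (A *m v)) -[M0](subrK (A *m M *m A^T)).
  by rewrite ![_ - _ + _]addrC -[v0 - _]scale1r -[M0 - _]scale1r Hr r0 horner0 eqxx.
rewrite subr_eq0 => /eqP ptq.
have := Hp 0; rewrite !scale0r !addr0 => ->.
have := Ht 0; rewrite !scale0r !addr0 => ->.
have := Hq 0; rewrite !scale0r !addr0 => ->.
by rewrite ptq hornerM.
Qed.

End Represents.

(** * Bringing (v, M) to tridiagonal form *)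

Section TridiagonalForm.
Variables (R : rcfType) (D : nat).
Implicit Types (v x y z : 'cV[R]_D.+1) (M A H X Y : 'M[R]_D.+1).

Lemma sqnorm_eq0 x : (sqnorm x == 0) = (x == 0).
Proof.
apply/eqP/eqP => [|->]; last by rewrite /sqnorm big1 // => i _; rewrite mxE expr0n.
move=> H; apply/colP => i; rewrite mxE; apply/eqP; rewrite -sqrf_eq0.
by move/psumr_eq0P: H => -> // j _; exact: sqr_ge0.
Qed.

Lemma sqnorm_ge0 x : 0 <= sqnorm x.
Proof. by apply: sumr_ge0 => i _; exact: sqr_ge0. Qed.

Lemma mul_colT x y : x^T *m y = ((x^T *m y) 0 0)%:M.
Proof. exact: mx11_scalar. Qed.

Lemma householder x y : sqnorm x = sqnorm y ->
  exists H, [/\ orthogonal_mx H, H *m x = y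
    & forall z, (x - y)^T *m z = 0 -> H *m z = z].
Proof.
move=> xy; have [->|ne] := eqVneq x y.
  by exists 1%:M; split=> [||z _]; rewrite ?mul1mx // /orthogonal_mx mul1mx trmx1.
have [u uE] : exists u : 'cV[R]_D.+1, u = x - y by exists (x - y).
pose k : R := 2 / sqnorm u; rewrite -uE.
have u0 : sqnorm u != 0 by rewrite uE sqnorm_eq0 subr_eq0.
exists (1%:M - k *: (u *m u^T)); split.
- have ku : k * sqnorm u = 2 by rewrite divfK.
  have uu : u *m u^T *m (u *m u^T) = sqnorm u *: (u *m u^T).
    by rewrite -mulmxA (mulmxA u^T) mul_colT -sqnormE mul_scalar_mx -scalemxAr.
  have trH : (1%:M - k *: (u *m u^T))^T = 1%:M - k *: (u *m u^T).
    apply/matrixP => i j; rewrite !mxE eq_sym; congr (_ - _ * _).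
    by apply: eq_bigr => l _; rewrite !mxE mulrC.
  rewrite /orthogonal_mx trH.
  rewrite mulmxBl !mulmxBr !mul1mx mulmx1 -scalemxAl -scalemxAr uu !scalerA.
  rewrite -mulrA ku mulr_natr mulr2n scalerDl.
  set P := k *: _; have -> : P - (P + P) = - P by rewrite opprD addrA subrr sub0r.
  by rewrite opprK addrNK.
(* For u = x - y, twice the product of u and x is |u|^2 + |x|^2 - |y|^2, and the norms agree. *)
- have ux : (u^T *m x) 0 0 = sqnorm u / 2.
    have e : 2 * (u^T *m x) 0 0 = sqnorm u + (sqnorm x - sqnorm y).
      rewrite mxE mulr_sumr /sqnorm -sumrN -!big_split /=.
      by apply: eq_bigr => i _; rewrite uE !mxE; ring.
    by move: e; rewrite xy subrr addr0 => <-; rewrite mulrAC divff ?mul1r ?pnatr_eq0.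
  rewrite mulmxBl mul1mx -scalemxAl -mulmxA mul_colT ux mul_mx_scalar scalerA.
  rewrite /k mulrA divfK // divff // ?pnatr_eq0 // scale1r.
  by rewrite uE subKr.
- move=> z uz; rewrite mulmxBl mul1mx -scalemxAl -mulmxA uz.
  by rewrite mulmx0 scaler0 subr0.
Qed.

(** Both x and its image live in the rows below index c, so their difference is orthogonal to every
    e_r with r at least c; the reflection thus leaves finished columns alone. *)
Lemma householder_ecol x c : (0 < c <= D.+1)%N -> x != 0 ->
  (forall i : 'I_D.+1, (c <= i)%N -> x i 0 = 0) ->
  exists H, [/\ orthogonal_mx H, H *m x = Num.sqrt (sqnorm x) *: ecol R D c.-1
    & forall r, (c <= r <= D)%N -> H *m ecol R D r = ecol R D r].
Proof.
move=> cD x0 xc; have c1D : (c.-1 <= D)%N by lia.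
have e : sqnorm x = sqnorm (Num.sqrt (sqnorm x) *: ecol R D c.-1).
  by rewrite sqnormZ sqnorm_ecol // mulr1 sqr_sqrtr // sqnorm_ge0.
have [H [oH Hx Hz]] := householder e; exists H; split=> // r rD.
apply: Hz; rewrite {2}/ecol -colE; apply/colP => i; rewrite (ord1 i) !mxE eqxx andbT.
rewrite xc -?val_eqE /= ?inordK //; [|lia|lia|lia].
by rewrite (_ : _ == _ = false) ?mulr0 ?subr0 //; lia.
Qed.

Lemma mul_ecolE M a b : (M *m ecol R D b) a 0 = M a (inord b).
Proof. by rewrite mul_ecol mxE. Qed.

Lemma orthogonal_mul A B : orthogonal_mx A -> orthogonal_mx B ->
  orthogonal_mx (A *m B : 'M[R]_D.+1).
Proof.
by rewrite /orthogonal_mx => HA HB; rewrite trmx_mul -mulmxA (mulmxA B) HB mul1mx.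
Qed.

Lemma orthogonal_tr A : orthogonal_mx A -> orthogonal_mx A^T.
Proof. by move=> HA; rewrite /orthogonal_mx trmxK mulmx1C. Qed.

Lemma skew_conj A M : skew_mx M -> skew_mx (A *m M *m A^T).
Proof. by move=> HM; rewrite /skew_mx !trmx_mul trmxK HM mulNmx mulmxN mulmxA. Qed.

Lemma tridiagonal_form_step v M k : skew_mx M -> (k < D)%N ->
  tridiag_above (D - k) v M -> 0 < v (inord D) 0 ->
  (forall j, (j < k)%N -> 0 < offdiag M j) ->
  upper_col M (inord (D - k)) != 0 ->
  exists H, [/\ orthogonal_mx H,
    tridiag_above (D - k.+1) (H *m v) (H *m M *m H^T),
    0 < (H *m v) (inord D) 0
    & forall j, (j < k.+1)%N -> 0 < offdiag (H *m M *m H^T) j].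
Proof.
move=> HM kD HT vD Hoff x0.
pose c := (D - k)%N; have c0 : (0 < c <= D.+1)%N by lia.
have cD : (c <= D)%N by lia.
have [|H [oH Hx HE]] := householder_ecol c0 x0.
  by move=> i ci; rewrite mxE inordK // ltnNge ci.
pose M' := H *m M *m H^T.
have ME r : (c <= r <= D)%N -> M' *m ecol R D r = H *m (M *m ecol R D r).
  move=> rD; rewrite -{1}(HE r rD) /M' -!mulmxA (mulmxA H^T) (mulmx1C oH).
  by rewrite mul1mx.
(* Column r is a combination of e_{r-1} and, when r < D, e_{r+1}, all fixed by H since r - 1 is at
   least c. *)
have Mfix r : (c < r <= D)%N -> M' *m ecol R D r = M *m ecol R D r.
  move=> /andP[cr rD]; rewrite ME; last by lia.
  have [rlt|rge] := ltnP r D.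
    rewrite (tridiag_above_col HM HT); last by lia.
    rewrite (tridiag_above_upper_col HT); last by lia.
    by rewrite mulmxBr -!scalemxAr !HE //; lia.
  rewrite (_ : r = D); last by lia.
  rewrite skew_last_col // (tridiag_above_upper_col HT); last by lia.
  by rewrite -scalemxAr HE //; lia.
have Mc a : (a < c)%N ->
    M' (inord a) (inord c) = (a == c.-1)%:R * Num.sqrt (sqnorm (upper_col M (inord c))).
  move=> ac; rewrite -mul_ecolE ME ?leqnn //.
  have [clt|cge] := ltnP c D.
    rewrite (tridiag_above_col HM HT) // ?leqnn // mulmxBr Hx -scalemxAr HE; last by lia.
    rewrite mxE [X in X + _]mxE [X in _ + X]mxE [X in - X]mxE !ecolE //; [|lia].
    rewrite inordK; last by lia.
    by rewrite (_ : _ == c.+1 = false) ?mulr0 ?subr0 1?mulrC //; lia.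
  have -> : M *m ecol R D c = upper_col M (inord c).
    by rewrite (_ : c = D) ?skew_last_col //; lia.
  rewrite Hx mxE ecolE; last by lia.
  by rewrite inordK 1?mulrC //; lia.
have Hv : H *m v = v.
  by rewrite (tridiag_above_v HT) -scalemxAr HE // cD leqnn.
exists H; rewrite Hv; split=> //; first split.
- by case: HT.
- move=> a b Db ab; rewrite -/M' -(inord_val a) -(inord_val b).
  have [bc|bc] := eqVneq (b : nat) c.
    rewrite bc Mc; last by lia.
    have /negbTE -> : (a : nat) != c.-1 by lia.
    by rewrite mul0r.
  have bD := ltn_ord b.
  rewrite -mul_ecolE Mfix; last by lia.
  rewrite mul_ecolE !inord_val; case: HT => _; apply; lia.
- move=> j jk; rewrite -/M' /offdiag.
  have [->|jk'] := eqVneq j k.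
    rewrite -/c (_ : D - k.+1 = c.-1)%N; last by lia.
    rewrite Mc ?eqxx ?mul1r ?sqrtr_gt0; last by lia.
    by rewrite lt_neqAle eq_sym sqnorm_eq0 x0 sqnorm_ge0.
  rewrite -mul_ecolE Mfix; last by lia.
  by rewrite mul_ecolE; apply: Hoff; lia.
Qed.

Lemma tridiagonal_form v M : skew_mx M -> v != 0 ->
  (forall k A, (k < D)%N -> orthogonal_mx A ->
     tridiag_above (D - k) (A *m v) (A *m M *m A^T) ->
     upper_col (A *m M *m A^T) (inord (D - k)) != 0) ->
  exists A, [/\ orthogonal_mx A,
    tridiag_above 0 (A *m v) (A *m M *m A^T),
    0 < (A *m v) (inord D) 0
    & forall j, (j < D)%N -> 0 < offdiag (A *m M *m A^T) j].
Proof.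
move=> HM v0 Hup; rewrite -[in tridiag_above 0](subnn D).
suff H k : (k <= D)%N -> exists A, [/\ orthogonal_mx A,
    tridiag_above (D - k) (A *m v) (A *m M *m A^T),
    0 < (A *m v) (inord D) 0
    & forall j, (j < k)%N -> 0 < offdiag (A *m M *m A^T) j] by exact: H.
elim: k => [_|k IH kD].
  have D0 : (0 < D.+1 <= D.+1)%N by rewrite leqnn.
  have [i iD|H [oH Hx _]] := householder_ecol D0 v0.
    by have := ltn_ord i; lia.
  exists H; split=> //; rewrite Hx /=; last first.
    rewrite mxE ecolE // inordK // eqxx mulr1 sqrtr_gt0.
    by rewrite lt_neqAle eq_sym sqnorm_eq0 v0 sqnorm_ge0.
  split=> [a aD|a b]; last by have := ltn_ord b; lia.
  by rewrite mxE ecolE // (_ : _ == _ = false) ?mulr0 //; lia.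
have [|A [oA HT HD Hoff]] := IH; first exact: ltnW.
have [H [oH HT' HD' Hoff']] := tridiagonal_form_step (skew_conj A HM) kD HT HD Hoff
  (Hup k A kD oA HT).
exists (H *m A); rewrite trmx_mul !mulmxA -(mulmxA H) -(mulmxA _ A) in HT' HD' Hoff' *.
split=> //; first exact: orthogonal_mul.
Qed.

(** * The moving frame *)

Definition frame v M : 'M[R]_D.+1 :=
  \matrix_(a, i) (lvec v M (D - a) i 0 / Num.sqrt (sqnorm (lvec v M (D - a)))).

Lemma frame_orthogonal A v M : orthogonal_mx A ->
  frame (A *m v) (A *m M *m A^T) = frame v M *m A^T.
Proof.
move=> oA; apply/matrixP => a i.
rewrite !mxE lvec_orthogonal // sqnorm_orthogonal // mxE mulr_suml.
by apply: eq_bigr => l _; rewrite !mxE [RHS]mulrC mulrA.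
Qed.

(** The positivity in the conclusion shows that the normalising denominators of [frame] do not
    vanish, which smoothness needs. *)
Lemma frame_unique A v M : orthogonal_mx A -> skew_mx M ->
  tridiag_above 0 (A *m v) (A *m M *m A^T) -> 0 < (A *m v) (inord D) 0 ->
  (forall j, (j < D)%N -> 0 < offdiag (A *m M *m A^T) j) ->
  A = frame v M /\ forall j, (j <= D)%N -> 0 < sqnorm (lvec v M j).
Proof.
move=> oA HM HT HD Hoff.
have H j : (j <= D)%N -> exists2 g, 0 < g & lvec v M j = g *: (A^T *m ecol R D (D - j)).
  move=> jD; have [+ _] := lanczos_full (skew_conj A HM) HT jD.
  have /andP[g0 _] := lcoef_gt0 HD Hoff jD.
  rewrite lvec_orthogonal // => /(congr1 (mulmx A^T)).
  rewrite mulmxA (mulmx1C oA) mul1mx => ->.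
  by eexists; [exact: g0 | rewrite scalemxAr].
have N j g : (j <= D)%N ->
    sqnorm (g *: (A^T *m ecol R D (D - j))) = g ^+ 2.
  move=> jD; rewrite sqnormZ sqnorm_orthogonal ?sqnorm_ecol ?leq_subr ?mulr1 //.
  exact: orthogonal_tr.
split=> [|j jD]; last by have [g g0 ->] := H j jD; rewrite N // exprn_gt0.
apply/matrixP => a i; rewrite mxE.
have aD : (a <= D)%N by rewrite -ltnS ltn_ord.
have [g g0 ->] := H (D - a)%N (leq_subr _ _).
rewrite N ?leq_subr // sqrtr_sqr gtr0_norm // mxE mulrAC divff ?gt_eqF // mul1r.
by rewrite mul_ecolE mxE subKn // inord_val.
Qed.

(** * Transversality *)

Definition superdiag M b : R := if (0 < b)%N then M (inord b.-1) (inord b) else 0.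

(** At b = 0 and b = D one neighbour does not exist; its coefficient is set to 0, so the default
    index returned by [inord] is harmless. *)
Lemma tridiagonal_col v M b : skew_mx M -> tridiag_above 0 v M -> (b <= D)%N ->
  M *m ecol R D b = superdiag M b *: ecol R D b.-1
    - (if (b < D)%N then superdiag M b.+1 else 0) *: ecol R D b.+1.
Proof.
move=> HM HT bD.
have -> : superdiag M b *: ecol R D b.-1 = upper_col M (inord b).
  rewrite /superdiag; case: ltnP => b0.
    by rewrite (tridiag_above_upper_col HT) // b0.
  by rewrite scale0r; apply/colP => i; rewrite !mxE inordK // ltnNge (leq_trans b0).
case: ltnP => bD'; first by rewrite (tridiag_above_col HM HT).
by rewrite scale0r subr0 (_ : b = D) ?skew_last_col //; lia.
Qed.

Section Transversality.
Variables (v x : 'cV[R]_D.+1) (M Y : 'M[R]_D.+1).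
Hypotheses (HM : skew_mx M) (HT : tridiag_above 0 v M).

(* [trans_col j a] is the entry (a, D - j) above the diagonal of the skew matrix
   X solving [X v = x] and [X M - M X = Y] off the cross-section: the equation at
   (a, D - j) determines the entry (a, D - j - 1) from the columns to its right. *)
Fixpoint trans_col (j : nat) (a : nat) {struct j} : R :=
  if j is j'.+1 then
    (Y (inord a) (inord (D - j')%N)
     + superdiag M (D - j').+1 * (if j' is j''.+1 then trans_col j'' a else 0)
     + superdiag M a.+1 * trans_col j' a.+1
     - superdiag M a * trans_col j' a.-1) / superdiag M (D - j')
  else x (inord a) 0 / v (inord D) 0.

Definition trans_mx : 'M[R]_D.+1 :=
  \matrix_(a, b) (if (a < b)%N then trans_col (D - b) a
                  else if (b < a)%N then - trans_col (D - a) b else 0).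

Lemma trans_mx_skew : skew_mx trans_mx.
Proof.
by apply/matrixP => i j; rewrite !mxE; case: ltngtP; rewrite ?opprK ?oppr0.
Qed.

Lemma trans_mx_upper a b : (a < b)%N -> (b <= D)%N ->
  trans_mx (inord a) (inord b) = trans_col (D - b) a.
Proof. by move=> ab bD; rewrite mxE !inordK ?ab //; lia. Qed.

Lemma trans_mx_v (a : 'I_D.+1) : v (inord D) 0 != 0 -> (a < D)%N ->
  (trans_mx *m v) a 0 = x a 0.
Proof.
move=> vD aD; rewrite (tridiag_above_v HT) -scalemxAr mxE mul_ecolE.
rewrite -[in trans_mx a](inord_val a) trans_mx_upper // subnn /= inord_val.
by rewrite mulrC divfK.
Qed.

(** The commutator at (a, b) involves X only at (a, b-1), (a, b+1), (a+1, b) and (a-1, b). Since a +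
    1 < b, these lie strictly above the diagonal, and only (a, b-1) belongs to a column left of b;
    its coefficient is a nonzero superdiagonal entry. *)
Lemma trans_mx_M (a b : 'I_D.+1) :
  (forall b, (0 < b <= D)%N -> superdiag M b != 0) -> (a.+1 < b)%N ->
  (trans_mx *m M + M *m trans_mx^T) a b = Y a b.
Proof.
move=> Moff ab; have bD : (b <= D)%N by rewrite -ltnS ltn_ord.
rewrite trans_mx_skew mulmxN mxE [X in _ + X]mxE.
have -> : (trans_mx *m M) a b = superdiag M b * trans_mx a (inord b.-1)
    - (if (b < D)%N then superdiag M b.+1 else 0) * trans_mx a (inord b.+1).
  rewrite -[in LHS](inord_val b) -(mul_ecolE (trans_mx *m M)) -mulmxA (tridiagonal_col HM HT bD).
  rewrite mulmxBr -!scalemxAr mxE [X in X + _]mxE [X in _ + X]mxE [X in - X]mxE.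
  by rewrite !mul_ecolE.
(* Row a of M is minus its column a. For a = 0 the predecessor is again 0, but [superdiag M 0]
   vanishes. *)
have -> : (M *m trans_mx) a b = superdiag M a.+1 * trans_mx (inord a.+1) b
    - superdiag M a * trans_mx (inord a.-1) b.
  have aD : (a <= D)%N by lia.
  have sumE c (F : 'I_D.+1 -> R) : \sum_k ecol R D c k 0 * F k = F (inord c).
    rewrite (bigD1 (inord c)) //= mxE !eqxx mul1r big1 ?addr0 // => k /negbTE kc.
    by rewrite mxE kc mul0r.
  rewrite mxE -(sumE a.+1 (trans_mx^~ b)) -(sumE a.-1 (trans_mx^~ b)).
  rewrite !mulr_sumr -sumrN -big_split /=; apply: eq_bigr => k _.
  have := congr1 (fun z : 'cV_D.+1 => z k 0) (tridiagonal_col HM HT aD).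
  rewrite /= mul_ecolE inord_val (_ : (a < D)%N); last by lia.
  rewrite [M a k]skew_entry // => ->.
  have -> (p q : R) (y z : 'cV[R]_D.+1) :
      (p *: y - q *: z) k 0 = p * y k 0 - q * z k 0 by rewrite !mxE.
  by ring.
rewrite -(inord_val a) -(inord_val b) !inordK //.
have b0 : superdiag M b != 0 by apply: Moff; lia.
have bE : (D - b.-1 = (D - b).+1)%N by lia.
have cE a' : trans_col (D - b).+1 a' * superdiag M b =
    Y (inord a') (inord b)
    + superdiag M b.+1 * (if (b < D)%N then trans_col (D - b.+1) a' else 0)
    + superdiag M a'.+1 * trans_col (D - b) a'.+1
    - superdiag M a' * trans_col (D - b) a'.-1.
  rewrite /= subKn // divfK //; case: ltnP => bD'.
    by rewrite (_ : (D - b = (D - b.+1).+1)%N) //; lia.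
  by rewrite (_ : (D - b = 0)%N) //; lia.
rewrite (@trans_mx_upper a b.-1) ?(@trans_mx_upper a.+1 b) ?(@trans_mx_upper a.-1 b);
  try lia.
rewrite bE [superdiag M b * _]mulrC cE; case: ltnP => bD'; last by ring.
by rewrite trans_mx_upper //; [ring | lia].
Qed.

End Transversality.
End TridiagonalForm.

(** * Smoothness of elementary functions *)

Section Elementary.
Variables (R : realType) (N : nat).
Local Notation V := 'rV[R]_N.

(* Closed under directional derivatives, so membership is already smoothness. *)
Inductive elementary (S : set V) : (V -> R) -> Prop :=
| el_const a : elementary S (fun _ => a)
| el_coord i : elementary S (fun x => x 0 i)
| el_add f g : elementary S f -> elementary S g ->
    elementary S (fun x => f x + g x)
| el_mul f g : elementary S f -> elementary S g ->
    elementary S (fun x => f x * g x)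
| el_inv f : elementary S f -> (forall x, S x -> f x != 0) ->
    elementary S (fun x => (f x)^-1)
| el_sqrt f : elementary S f -> (forall x, S x -> 0 < f x) ->
    elementary S (fun x => Num.sqrt (f x)).

Lemma differentiable_sqrt (r : R) : 0 < r -> differentiable (@Num.sqrt R) r.
Proof. by move=> r0; apply/derivable1_diffP; have [] := is_derive1_sqrt r0. Qed.

Lemma elementary_differentiable S f x :
  elementary S f -> S x -> differentiable f x.
Proof.
move=> Hf Sx; elim: Hf => {f} [a|i|f g _ df _ dg|f g _ df _ dg|f _ df f0|f _ df f0].
- exact: differentiable_cst.
- exact: differentiable_coord.
- exact: differentiableD.
- exact: differentiableM.
- by apply: differentiableV => //; exact: f0.
- by apply: differentiable_comp => //; apply: differentiable_sqrt; exact: f0.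
Qed.

Lemma derive_coord (x v : V) i : 'D_v (fun y : V => y 0 i) x = v 0 i.
Proof.
have := derive_mx (@derivable_id _ _ x v); rewrite derive_id => /rowP/(_ i) /= ->.
by rewrite mxE.
Qed.

Lemma derive_sqrt_comp (f : V -> R) x v : differentiable f x -> 0 < f x ->
  'D_v (fun y => Num.sqrt (f y)) x = 'D_v f x * (2 * Num.sqrt (f x))^-1.
Proof.
move=> df f0; have ds := differentiable_sqrt f0.
rewrite deriveE; last exact: differentiable_comp.
rewrite (diff_comp df ds) /= (deriveE _ df) deriv1E; last exact/derivable1_diffP.
by rewrite derive1E derive_sqrt.
Qed.

Lemma elementary_derive S f v : elementary S f ->
  exists2 g, elementary S g & forall x, S x -> 'D_v f x = g x.
Proof.
have deriv h x : elementary S h -> S x -> derivable h x v.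
  by move=> Hh Sx; apply: diff_derivable; exact: elementary_differentiable Sx.
elim=> {f} [a|i|f g Hf [f' Hf' fE] Hg [g' Hg' gE]
  |f g Hf [f' Hf' fE] Hg [g' Hg' gE]|f Hf [f' Hf' fE] f0|f Hf [f' Hf' fE] f0].
- by exists (fun _ => 0) => [|x _]; [exact: el_const | rewrite derive_cst].
- by exists (fun _ => v 0 i) => [|x _]; [exact: el_const | rewrite derive_coord].
- exists (fun x => f' x + g' x) => [|x Sx]; first exact: el_add.
  by rewrite deriveD ?fE ?gE //; exact: deriv.
- exists (fun x => f x * g' x + g x * f' x) => [|x Sx].
    by apply: el_add; exact: el_mul.
  by rewrite deriveM ?fE ?gE //; exact: deriv.
- exists (fun x => - 1 * ((f x)^-1 * (f x)^-1) * f' x) => [|x Sx].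
    apply: el_mul => //; apply: el_mul; first exact: el_const.
    by apply: el_mul; exact: el_inv.
  rewrite deriveV ?fE //; [|exact: f0|exact: deriv].
  by rewrite mulN1r -invfM.
- exists (fun x => f' x * (2 * Num.sqrt (f x))^-1) => [|x Sx].
    apply: el_mul => //; apply: el_inv.
      by apply: el_mul; [exact: el_const | exact: el_sqrt].
    by move=> x Sx; rewrite mulf_neq0 // gt_eqF // sqrtr_gt0 f0.
  rewrite derive_sqrt_comp ?fE //; last exact: f0.
  exact: elementary_differentiable Sx.
Qed.

Lemma mx_continuous_at p q (f : V -> 'M[R]_(p, q)) (x : V) :
  (forall i j, {for x, continuous (fun y => f y i j)}) ->
  {for x, continuous f}.
Proof.
move=> H; have F0 : Filter (nbhs x) by exact: nbhs_filter.
apply/(@cvg_ballP R 'M[R]_(p, q) _ _ F0) => e e0.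
suff : \forall y \near x, forall i j, ball (f x i j) e (f y i j).
  by apply: filterS => y Hy; split.
apply: (@filter_forall _ _ _ _ F0) => i; apply: (@filter_forall _ _ _ _ F0) => j.
by have /(@cvg_ballP R R _ _ F0)/(_ e e0) := H i j.
Qed.

(** U lies in a subspace and need not be open in the ambient space, so derivatives are computed on
    an ambient open S containing it. *)
Lemma smooth_on_elementary p q (G : V -> Prop) (S U : set V)
    (f : V -> 'M[R]_(p, q)) :
  open S -> (forall x, U x -> S x) ->
  (forall i j, exists2 g, elementary S g & forall x, S x -> f x i j = g x) ->
  smooth_on G U f.
Proof.
move=> oS US Hf vs _.
have nearE (h h' : V -> R) x : (forall y, S y -> h y = h' y) -> S x ->
    {near x, h =1 h'}.
  by move=> E Sx; apply: filterS (open_nbhs_nbhs (conj oS Sx)) => y Sy; exact: E.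
have derP (h : V -> 'M[R]_(p, q)) :
    (forall i j, exists2 g, elementary S g & forall x, S x -> h x i j = g x) ->
    forall x v, S x -> derivable h x v.
  move=> Hh x v Sx; apply/derivable_mxP => i j; have [g Hg gE] := Hh i j.
  apply: (@near_eq_derivable _ _ _ g).
    by apply: nearE => // y Sy; rewrite gE.
  by apply: diff_derivable; exact: elementary_differentiable Sx.
have {}Hf : forall i j, exists2 g, elementary S g &
    forall x, S x -> iter_dir_deriv vs f x i j = g x.
  elim: vs => // v vs IH i j /=; have [g Hg gE] := IH i j.
  have [g' Hg' g'E] := elementary_derive v Hg.
  exists g' => // x Sx; rewrite derive_mx; last exact: derP.
  rewrite mxE -g'E //; apply: near_eq_derive.
  exact: (nearE _ _ x gE Sx).
split=> [x v Ux _|]; first by apply: derP => //; exact: US.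
apply: continuous_in_subspaceT => x; rewrite inE => Ux.
apply: mx_continuous_at => i j; have [g Hg gE] := Hf i j.
have Sx := US x Ux.
have cg : {for x, continuous g}.
  by apply: differentiable_continuous; exact: elementary_differentiable Sx.
rewrite /prop_for /continuous_at gE //.
apply: cvg_trans cg; apply: (@near_eq_cvg _ _ _ (nbhs_filter x)).
by apply: (nearE _ _ x _ Sx) => y Sy; rewrite gE.
Qed.

Lemma elementary_continuous f : elementary setT f -> continuous f.
Proof.
move=> Hf x; apply: differentiable_continuous.
exact: (elementary_differentiable Hf).
Qed.

End Elementary.

(** * The cross-section *)

Section CrossSection.
Variables (R : realType) (D n : nat).
Hypothesis n2 : (2 <= n)%N.
Local Notation d := (D.+1).
Local Notation vC c := (map_mx (@cplx R) (tn_v c)).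
Local Notation MC c := (map_mx (@cplx R) (tn_M c)).
Implicit Types (c x : tn_T R d n) (A : 'M[R]_d).

Definition tridiag_pos (v : 'cV[R]_d) (M : 'M[R]_d) : Prop :=
  [/\ tridiag_above 0 v M, 0 < v (inord D) 0
    & forall j, (j < D)%N -> 0 < offdiag M j].

Lemma tn_K_tridiag c : c \in tn_g R d n ->
  tn_K c <-> tridiag_pos (tn_v c) (tn_M c).
Proof.
move=> cg; split=> [[_ Hv HM vD Hoff]|[[Hv HM] vD Hoff]].
  split; first split.
  - by move=> a aD; rewrite mxE Hv.
  - by move=> a b _ ab; rewrite tn_ME // HM.
  - by rewrite mxE; apply: vD; rewrite inordK.
  - by move=> j jD; rewrite /offdiag tn_ME //; apply: Hoff; rewrite !inordK; lia.
split=> //.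
- by move=> a aD; have := Hv a aD; rewrite mxE.
- by move=> a b ab; rewrite -tn_ME // HM //; lia.
- move=> a aD; move: vD; rewrite mxE (_ : inord D = a) //.
  by apply: val_inj; rewrite /= inordK.
- move=> a b ba; have bD := ltn_ord b; have := Hoff (D - b)%N.
  rewrite /offdiag tn_ME // (_ : D - (D - b).+1 = a)%N; last by lia.
  rewrite (_ : D - (D - b) = b)%N; last by lia.
  by rewrite !inord_val; apply; lia.
Qed.

Lemma tridiag_above_cplx m (v : 'cV[R]_d) (M : 'M[R]_d) : tridiag_above m v M ->
  tridiag_above m (map_mx (@cplx R) v) (map_mx (@cplx R) M).
Proof.
move=> [Hv HM]; split=> [a aD|a b mb ab]; rewrite mxE ?Hv ?HM //.
Qed.

Lemma skew_cplx (M : 'M[R]_d) : skew_mx M -> skew_mx (map_mx (@cplx R) M).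
Proof.
move=> HM; apply/matrixP => i j; rewrite !mxE (skew_entry j i HM).
by rewrite /cplx /=; congr Complex; rewrite oppr0.
Qed.

Lemma cplx_eq0 (r : R) : (cplx r == 0) = (r == 0).
Proof. by rewrite eq_complex /= eqxx andbT. Qed.

Lemma tn_K_sub_U c : tn_K c -> tn_U c.
Proof.
move=> Kc; have cg : c \in tn_g R d n by case: Kc.
have [HT vD Hoff] := (tn_K_tridiag cg).1 Kc.
have HM := tn_M_skew c.
split=> //.
  have := sqnorm_eq0 (tn_v c); rewrite /sqnorm => ->; apply/eqP => v0.
  by move: vD; rewrite v0 mxE ltxx.
have HMC := skew_cplx HM; have HTC := tridiag_above_cplx HT.
have nz j : (j <= D)%N ->
    (lscal (vC c) (MC c) j != 0) && (sqnorm (lvec (vC c) (MC c) j) != 0).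
  move=> jD; have [-> ->] := lanczos_full HMC HTC jD.
  have [||g0 ->] // := andP (@lcoef_neq0 _ (vC c (inord D) 0) (offdiag (MC c)) D _ _ j jD).
  - by rewrite mxE cplx_eq0 gt_eqF.
  - by move=> i iD; rewrite /offdiag mxE cplx_eq0 gt_eqF //; exact: Hoff.
  by rewrite sqnormZ sqnorm_ecol ?leq_subr // mulr1 expf_neq0.
case=> [|[|j]] // jD; have {}jD : (j < D)%N by lia.
have /andP[t0 w0] := nz j (ltnW jD); have /andP[t1 w1] := nz j.+1 jD.
eexists; eexists; split.
- apply: (@represents_f_lanczos R D j (vC c) (MC c)) => //.
    by case: HTC => Hv HMo; split=> // a b Db; apply: HMo; lia.
  by rewrite mulf_neq0 // expf_neq0.
- by rewrite mulf_neq0 // expf_neq0.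
- by rewrite mulf_neq0 // expf_neq0.
Qed.

(** If the column vanished, the target of f_{k+2} would be zero at the transformed point, and then P
    would vanish at c itself. *)
Lemma tn_U_upper_col c k A : tn_U c -> (k < D)%N -> orthogonal_mx A ->
  tridiag_above (D - k) (A *m tn_v c) (A *m tn_M c *m A^T) ->
  upper_col (A *m tn_M c *m A^T) (inord (D - k)) != 0.
Proof.
move=> [_ _ HU] kD oA HT.
have [|P [Q [HPQ _ P0]]] := HU k.+2; first by lia.
have mulE p q r (B : 'M[R]_(p, q)) (B' : 'M[R]_(q, r)) :
    map_mx (@cplx R) (B *m B') = map_mx (@cplx R) B *m map_mx (@cplx R) B'.
  exact: (map_mxM (real_complex R)).
pose AC := map_mx (@cplx R) A.
have oAC : orthogonal_mx AC.
  rewrite /orthogonal_mx /AC map_trmx -mulE oA.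
  exact: (map_mx1 (real_complex R)).
have := @represents_f_target _ _ _ _ _ _ (vC c) _ HPQ oAC (skew_cplx (tn_M_skew c)).
rewrite /AC map_trmx -!mulE => /(_ (tridiag_above_cplx HT)) E.
apply: contraNneq P0 => up0; rewrite E tn_target_upper; last by lia.
rewrite (_ : (D.+1 - k.+2).+1 = D - k)%N; last by lia.
rewrite (_ : upper_col _ _ = 0); last first.
  apply/colP => i; rewrite mxE [RHS]mxE; case: ifP => // ik; rewrite mxE.
  by have := congr1 (fun z : 'cV_d => z i 0) up0; rewrite mxE [RHS]mxE ik => ->.
by rewrite /sqnorm big1 ?mul0r // => i _; rewrite mxE expr0n.
Qed.

Lemma tn_act_K c A : c \in tn_g R d n ->
  tn_K (tn_act A c) <-> tridiag_pos (A *m tn_v c) (A *m tn_M c *m A^T).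
Proof.
move=> cg; rewrite -tn_v_act 1?ltnW // -tn_M_act //.
by apply: tn_K_tridiag; apply: tn_act_g; rewrite 1?ltnW.
Qed.

Lemma tn_U_orbit c : tn_U c ->
  exists A, orthogonal_mx A /\ tn_K (tn_act A c).
Proof.
move=> Uc; have [cg v0 _] := Uc.
have [||A [oA HT HD Hoff]] := @tridiagonal_form _ _ (tn_v c) (tn_M c) (tn_M_skew c).
- by rewrite -sqnorm_eq0.
- by move=> k A; exact: tn_U_upper_col.
by exists A; split=> //; apply/tn_act_K.
Qed.

Definition tn_frame c := frame (tn_v c) (tn_M c).

Lemma tn_frame_unique c A : c \in tn_g R d n -> orthogonal_mx A ->
  tn_K (tn_act A c) -> A = tn_frame c /\
  forall j, (j <= D)%N -> 0 < sqnorm (lvec (tn_v c) (tn_M c) j).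
Proof.
move=> cg oA /(tn_act_K _ cg)[HT HD Hoff].
by apply: frame_unique => //; exact: tn_M_skew.
Qed.

(** The tangent space of K is cut out by conditions on levels one and two, so X only has to match x
    in those coordinates; the remainder of x is y. *)
Lemma tn_K_transversal c x : tn_K c -> x \in tn_g R d n ->
  exists (y : tn_T R d n) (X : 'M[R]_d),
    [/\ tn_TK y, skew_mx X & x = y + tn_dact X c].
Proof.
move=> Kc xg; have cg : c \in tn_g R d n by case: Kc.
have [HT vD Hoff] := (tn_K_tridiag cg).1 Kc.
have HM := tn_M_skew c; have n1 : (0 < n)%N by exact: ltnW.
pose X := trans_mx (tn_v c) (tn_v x) (tn_M c) (tn_M x).
exists (x - tn_dact X c), X; split; [|exact: trans_mx_skew|by rewrite subrK].
split.
- by rewrite memvB // tn_dact_g.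
- move=> a aD; rewrite tn_coefD tn_coefN tn_coef1_dact // trans_mx_v ?gt_eqF //.
  by rewrite mxE subrr.
- move=> a b ab; rewrite tn_coefD tn_coefN tn_coef2_dact // trans_mx_M //.
    by rewrite tn_ME // subrr.
  move=> b' b'D; have := Hoff (D - b')%N; rewrite /offdiag /superdiag.
  rewrite (_ : D - (D - b').+1 = b'.-1)%N; last by lia.
  rewrite (_ : D - (D - b') = b')%N; last by lia.
  have /andP[-> _] := b'D; move=> H; rewrite gt_eqF // H //; lia.
Qed.

Lemma elementary_tn_coef (S : set (tn_T R d n)) w :
  elementary S (fun c => tn_coef c w).
Proof.
rewrite /tn_coef; case: insub => [i|]; [exact: el_coord | exact: el_const].
Qed.

Lemma elementary_tn_lanczos (S : set (tn_T R d n)) j :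
  (forall i, elementary S (fun c => lvec (tn_v c) (tn_M c) j i 0)) /\
  elementary S (fun c => sqnorm (lvec (tn_v c) (tn_M c) j)).
Proof.
have Hv i : elementary S (fun c => tn_v c i 0).
  by apply: closed_ext (elementary_tn_coef S [:: i]) => c; rewrite mxE.
have HM i i' : elementary S (fun c => tn_M c i i').
  have [ii'|ii'|ii'] := ltngtP i i'.
  - apply: closed_ext (elementary_tn_coef S [:: i; i']) => c.
    by rewrite mxE ii'.
  - apply: closed_ext (el_mul (el_const S (-1)) (elementary_tn_coef S [:: i'; i])) => c.
    by rewrite mxE ltnNge (ltnW ii') /= ii' mulN1r.
  - by apply: closed_ext (el_const S 0) => c; rewrite mxE ii' ltnn.
have [w _ _ _] := closed_lanczos (@el_const R _ S) (@el_add R _ S) (@el_mul R _ S) j Hv HM.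
split=> //.
exact: (closed_sqnorm (@el_const R _ S) (@el_add R _ S) (@el_mul R _ S) w).
Qed.

Lemma tn_frame_smooth :
  smooth_on (fun x => x \in tn_g R d n) (@tn_U R d n) tn_frame.
Proof.
(* Positivity of this continuous function defines an open set that contains U and on which every row
   of the frame can be normalised. *)
pose h c := \prod_(j < D.+1) sqnorm (lvec (tn_v c) (tn_M c) j).
pose S : set (tn_T R d n) := [set c | 0 < h c]%classic.
have Hpos c : S c -> forall j, (j <= D)%N -> 0 < sqnorm (lvec (tn_v c) (tn_M c) j).
  move=> Sc j jD; rewrite lt_neqAle sqnorm_ge0 andbT eq_sym.
  move: Sc; rewrite /S /= => /gt_eqF/negbT; rewrite /h => /prodf_neq0.
  by move=> /(_ (Ordinal (jD : (j < D.+1)%N)) isT).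
apply: (@smooth_on_elementary _ _ _ _ _ S).
- have hc : continuous h.
    apply: elementary_continuous.
    apply: (closed_prod (@el_const R _ setT) (@el_mul R _ setT)) => j.
    exact: (elementary_tn_lanczos setT j).2.
  suff : open (h @^-1` [set r : R | 0 < r])%classic by [].
  by apply: open_comp => [c _|]; [exact: hc | exact: open_gt].
- move=> c Uc; have [A [oA KA]] := tn_U_orbit Uc.
  have [cg _ _] := Uc; have [_ H] := tn_frame_unique cg oA KA.
  by rewrite /S /= prodr_gt0 // => j _; apply: H; rewrite -ltnS.
- move=> a i; have aD : (D - a <= D)%N by rewrite leq_subr.
  have [w s] := elementary_tn_lanczos S (D - a).
  exists (fun c => lvec (tn_v c) (tn_M c) (D - a) i 0 *
    (Num.sqrt (sqnorm (lvec (tn_v c) (tn_M c) (D - a))))^-1).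
    apply: el_mul => //; apply: el_inv; first by apply: el_sqrt => // c /Hpos; exact.
    by move=> c /Hpos H; rewrite gt_eqF // sqrtr_gt0 H.
  by move=> c _; rewrite mxE.
Qed.

End CrossSection.

Theorem theorem4p3 (R : realType) (d n : nat) :
  (2 <= d)%N -> (2 <= n)%N ->
  (* K is contained in U *)
  (forall c : tn_T R d n, tn_K c -> tn_U c) /\
  (* K meets every orbit in U *)
  (forall c : tn_T R d n, tn_U c ->
     exists A : 'M[R]_d, orthogonal_mx A /\ tn_K (tn_act A c)) /\
  (* ... at a unique point *)
  (forall (c : tn_T R d n) (A B : 'M[R]_d), tn_U c ->
     orthogonal_mx A -> orthogonal_mx B ->
     tn_K (tn_act A c) -> tn_K (tn_act B c) -> tn_act A c = tn_act B c) /\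
  (* ... transversally: T_c K + T_c (O_d . c) = g_{<=n} *)
  (forall c : tn_T R d n, tn_K c ->
     forall x : tn_T R d n, x \in tn_g R d n ->
       exists (y : tn_T R d n) (X : 'M[R]_d),
         [/\ tn_TK y, skew_mx X & x = y + tn_dact X c]) /\
  (* the induced moving frame rho_d : U -> O_d(R) *)
  (exists rho : tn_T R d n -> 'M[R]_d,
     [/\ forall c, tn_U c -> orthogonal_mx (rho c) /\ tn_K (tn_act (rho c) c),
         forall c A, tn_U c -> orthogonal_mx A -> tn_K (tn_act A c) ->
           A = rho c,
         forall c A, tn_U c -> orthogonal_mx A ->
           rho (tn_act A c) = rho c *m A^T &
         smooth_on (fun x => x \in tn_g R d n) (@tn_U R d n) rho]).
Proof.
case: d => // D _ n2; split; first exact: tn_K_sub_U.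
split; first exact: tn_U_orbit.
split.
  move=> c A B Uc oA oB KA KB; have [cg _ _] := Uc.
  by rewrite (tn_frame_unique n2 cg oA KA).1 (tn_frame_unique n2 cg oB KB).1.
split; first by move=> c Kc x xg; exact: tn_K_transversal.
exists (@tn_frame R D n); split.
- move=> c Uc; have [A [oA KA]] := tn_U_orbit n2 Uc; have [cg _ _] := Uc.
  by rewrite -(tn_frame_unique n2 cg oA KA).1.
- by move=> c A Uc oA KA; have [cg _ _] := Uc; case: (tn_frame_unique n2 cg oA KA).
- move=> c A Uc oA; have [cg _ _] := Uc.
  rewrite /tn_frame tn_M_act // tn_v_act 1?ltnW //.
  exact: frame_orthogonal.
- exact: tn_frame_smooth.
Qed.
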